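(* Let $G$ be a connected Lie group endowed with a bi-invariant Riemannian metric, let $V: G \to \mathbb{R}$ be a smooth non-negative function, and suppose there exist $g_0 \in G$ and a smooth function $V_{\mathrm{ext}}: G \times G \to \mathbb{R}$ with $V_{\mathrm{ext}}(\cdot, g_0) = V$ and $V_{\mathrm{ext}}(hg, h\bar g) = V_{\mathrm{ext}}(g, \bar g)$ for all $g, \bar g, h \in G$. Let $g \in \Omega$. Then $g$ solves $$D_t^3 \dot g + R(D_t \dot g, \dot g)\dot g + \mathrm{grad}\, V(g(t)) = 0 \quad \text{on } [a,b]$$ if and only if $\xi := g^{-1}\dot g$ and $h := g_0^{-1} g$ solve \begin{align*} \dddot{\xi} + [\xi, \ddot\xi]_{\mathfrak g} + (L_{h^{-1}})_*\, \mathrm{grad}_1 V_{\mathrm{ext}}(h, e) &= 0, \\ \dot h &= (L_h)_*\xi . \end{align*}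
   Context: $G$ has identity $e$ and Lie algebra $\mathfrak g = T_eG$ with bracket $[\cdot,\cdot]_{\mathfrak g}$; $L_g(h) = gh$; for $X \in T_hG$, $gX := (L_g)_*X$, so $g^{-1}\dot g$ is a curve in $\mathfrak g$. A metric is bi-invariant if it is invariant under both left- and right-translations. $\nabla$ is the Levi-Civita connection of the bi-invariant metric, $D_t$ the covariant derivative along curves, $R(X,Y)Z = \nabla_X\nabla_Y Z - \nabla_Y\nabla_X Z - \nabla_{[X,Y]}Z$. $\mathrm{grad}_1$ is the gradient with respect to the first argument. Given $a<b$ and boundary data $(q_a,v_a),(q_b,v_b)\in TG$, $\Omega$ is the set of $C^1$, piecewise smooth curves $g:[a,b]\to G$ with $g(a)=q_a$, $g(b)=q_b$, $\dot g(a)=v_a$, $\dot g(b)=v_b$. Solutions of the displayed equation are understood to be $C^\infty$ curves on $[a,b]$. *)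

(* Defs.v *)
From HB Require Import structures.
From mathcomp Require Import all_boot all_order all_algebra.
From mathcomp Require Import all_classical all_reals topology normedtype derive numfun.

Set Implicit Arguments.
Unset Strict Implicit.
Unset Printing Implicit Defensive.

Import Order.TTheory GRing.Theory Num.Theory.
Import numFieldNormedType.Exports.

Local Open Scope classical_set_scope.
Local Open Scope ring_scope.

Section Calculus.
Context {R : realType}.

Definition iterD {E F : normedModType R} (s : seq E) (f : E -> F) : E -> F :=
  foldr (fun v g x => 'D_v g x) f s.

(* C^oo on an open subset U of a finite-dimensional space E: all iterated
   directional derivatives are differentiable (hence continuous) on U. *)
Definition smooth_on {E F : normedModType R} (U : set E) (f : E -> F) :=
  forall (s : seq E) (x : E), U x -> differentiable (iterD s f) x.

Section OneVariable.
Context {F : normedModType R}.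
Implicit Types (A : set R) (f : R -> F).

(* Derivatives relative to A; they are one-sided at the end points when A is a
   compact interval. *)
Definition dquot A f (t : R) : set_system F :=
  (fun s => (s - t)^-1 *: (f s - f t)) @ within A t^'.

Definition derivable_within A f (t : R) := cvg (dquot A f t).

Definition deriv_within A f : R -> F := fun t => lim (dquot A f t).

Definition derivn_within A (k : nat) f : R -> F := iter k (deriv_within A) f.

Definition C1_within A f :=
  (forall t, A t -> derivable_within A f t) /\
  {within A, continuous (deriv_within A f)}.

Definition smooth_within A f :=
  forall k t, A t -> derivable_within A (derivn_within A k f) t.

End OneVariable.
End Calculus.

Record chart (R : realType) (n : nat) (M : topologicalType) := Chart {
  cdom : set M;
  cmap :> M -> 'rV[R]_n;
  cinv : 'rV[R]_n -> M;
  cdom_open : open cdom;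
  cimg_open : open (cmap @` cdom);
  cmapK : forall p, cdom p -> cinv (cmap p) = p;
  cmap_continuous : {within cdom, continuous cmap};
  cinv_continuous : {within cmap @` cdom, continuous cinv} }.

Definition cimg (R : realType) (n : nat) (M : topologicalType)
  (c : chart R n M) : set 'rV[R]_n := c @` cdom c.

(* Smooth n-manifolds. The tangent space T_p M is represented by 'rV[R]_n: a
   tangent vector is given by its coordinates in the chart [chart_at p]. *)
HB.mixin Record Topological_isManifold (R : realType) (n : nat) M
    of Topological M := {
  manifold_hausdorff : hausdorff_space M;
  manifold_second_countable : @second_countable M;
  atlas : set (chart R n M);
  chart_at : M -> chart R n M;
  atlas_chart_at : forall p, atlas (chart_at p);
  mem_chart_at : forall p, cdom (chart_at p) p;
  atlas_compat : forall c d : chart R n M, atlas c -> atlas d ->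
    smooth_on (c @` (cdom c `&` cdom d)) (d \o cinv c) }.

#[short(type="manifoldType")]
HB.structure Definition Manifold (R : realType) (n : nat) :=
  {M of Topological M & Topological_isManifold R n M}.

Section Manifolds.
Context {R : realType} {n : nat}.
Local Notation E := 'rV[R]_n.
Implicit Types M N P : manifoldType R n.

Definition smooth_fun {M} {W : normedModType R} (f : M -> W) :=
  forall c : chart R n M, atlas c -> smooth_on (cimg c) (f \o cinv c).

Definition smooth_fun2 {M N} {W : normedModType R} (f : M -> N -> W) :=
  forall (c : chart R n M) (d : chart R n N), atlas c -> atlas d ->
    smooth_on (cimg c `*` cimg d) (fun z => f (cinv c z.1) (cinv d z.2)).

Definition smooth_map {M N} (f : M -> N) :=
  continuous f /\
  forall (c : chart R n M) (d : chart R n N), atlas c -> atlas d ->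
    smooth_on (cimg c `&` (f \o cinv c) @^-1` cdom d) (d \o f \o cinv c).

Definition smooth_map2 {M N P} (f : M -> N -> P) :=
  continuous (fun z : M * N => f z.1 z.2) /\
  forall (c : chart R n M) (d : chart R n N) (e : chart R n P),
    atlas c -> atlas d -> atlas e ->
    smooth_on [set z | [/\ cimg c z.1, cimg d z.2 &
                           cdom e (f (cinv c z.1) (cinv d z.2))]]
      (fun z => e (f (cinv c z.1) (cinv d z.2))).

(* The differential of a vector-valued function at p. For a chart c around p,
   [dfun c p u] is the coordinate vector of u : T_p M in c. *)
Definition dfun {M} {W : normedModType R} (f : M -> W) (p : M) (u : E) : W :=
  'd (f \o cinv (chart_at p)) (chart_at p p) u.

(* T_p M -> T_(f p) N, in the coordinates of chart_at p and chart_at (f p). *)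
Definition tmap {M N} (f : M -> N) (p : M) (u : E) : E :=
  dfun (chart_at (f p) \o f) p u.

(* The tangent vector at c^-1(x) with coordinates u in the chart c. *)
Definition tvec {M} (c : chart R n M) (x u : E) : E :=
  'd (chart_at (cinv c x) \o cinv c) x u.

(* Vector fields are functions X : M -> E with X p in T_p M. *)
Definition field_in {M} (c : chart R n M) (X : M -> E) : E -> E :=
  fun x => dfun c (cinv c x) (X (cinv c x)).

Definition smooth_field {M} (X : M -> E) :=
  forall c : chart R n M, atlas c -> smooth_on (cimg c) (field_in c X).

(* In coordinates, [X, Y]^k = X^i d_i Y^k - Y^i d_i X^k. *)
Definition bracket {M} (X Y : M -> E) : M -> E := fun p =>
  let c := chart_at p in
  'd (field_in c Y) (c p) (X p) - 'd (field_in c X) (c p) (Y p).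

Record is_riemannian {M} (met : M -> E -> E -> R) : Prop := IsRiemannian {
  metDl : forall p u v w, met p (u + v) w = met p u w + met p v w;
  metZl : forall p k u w, met p (k *: u) w = k * met p u w;
  metC : forall p u v, met p u v = met p v u;
  met_gt0 : forall p u, u != 0 -> 0 < met p u u;
  met_smooth : forall (c : chart R n M) (u v : E), atlas c ->
    smooth_on (cimg c) (fun x => met (cinv c x) (tvec c x u) (tvec c x v)) }.

Record is_levi_civita {M} (met : M -> E -> E -> R)
    (nabla : (M -> E) -> (M -> E) -> M -> E) : Prop := IsLeviCivita {
  nabla_smooth : forall X Y, smooth_field X -> smooth_field Y ->
    smooth_field (nabla X Y);
  nablaDl : forall X Y Z,
    smooth_field X -> smooth_field Y -> smooth_field Z ->
    forall p, nabla (fun q => X q + Y q) Z p = nabla X Z p + nabla Y Z p;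
  nablaZl : forall (f : M -> R) X Z,
    smooth_fun f -> smooth_field X -> smooth_field Z ->
    forall p, nabla (fun q => f q *: X q) Z p = f p *: nabla X Z p;
  nablaDr : forall X Y Z,
    smooth_field X -> smooth_field Y -> smooth_field Z ->
    forall p, nabla X (fun q => Y q + Z q) p = nabla X Y p + nabla X Z p;
  nabla_leibniz : forall (f : M -> R) X Y,
    smooth_fun f -> smooth_field X -> smooth_field Y ->
    forall p, nabla X (fun q => f q *: Y q) p =
      dfun f p (X p) *: Y p + f p *: nabla X Y p;
  nabla_torsion_free : forall X Y, smooth_field X -> smooth_field Y ->
    forall p, nabla X Y p - nabla Y X p = bracket X Y p;
  nabla_metric : forall X Y Z,
    smooth_field X -> smooth_field Y -> smooth_field Z ->
    forall p, dfun (fun q => met q (Y q) (Z q)) p (X p) =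
      met p (nabla X Y p) (Z p) + met p (Y p) (nabla X Z p) }.

(* R(u, v)w at p is the value at p of R(X, Y)Z for smooth fields extending
   u, v, w; it does not depend on the extension. *)
Definition curvature {M} (nabla : (M -> E) -> (M -> E) -> M -> E)
    (p : M) (u v w : E) : E :=
  xget 0 [set r | exists X Y Z,
    [/\ smooth_field X, smooth_field Y, smooth_field Z &
      [/\ X p = u, Y p = v, Z p = w &
        r = nabla X (nabla Y Z) p - nabla Y (nabla X Z) p
            - nabla (bracket X Y) Z p]]].

Definition grad {M} (met : M -> E -> E -> R) (f : M -> R) (p : M) : E :=
  xget 0 [set u | forall w, met p u w = dfun f p w].

Section Curves.
Context {M : manifoldType R n}.
Implicit Types (A : set R) (g : R -> M) (Y : R -> E).

Definition C1_curve A g :=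
  {within A, continuous g} /\
  forall c : chart R n M, atlas c ->
    C1_within (A `&` g @^-1` cdom c) (c \o g).

Definition smooth_curve A g :=
  {within A, continuous g} /\
  forall c : chart R n M, atlas c ->
    smooth_within (A `&` g @^-1` cdom c) (c \o g).

Definition piecewise_smooth_curve (a b : R) g :=
  exists s : seq R, itv_partition a b s /\
    forall i, (i < size s)%N ->
      smooth_curve `[nth b (a :: s) i, nth b (a :: s) i.+1] g.

Definition velocity A g : R -> E :=
  fun t => deriv_within A (chart_at (g t) \o g) t.

(* Vector fields along g are functions Y : R -> E with Y t in T_(g t) M. *)
Definition smooth_along A g Y :=
  forall c : chart R n M, atlas c ->
    smooth_within (A `&` g @^-1` cdom c) (fun t => dfun c (g t) (Y t)).

(* The properties that characterize D_t on the smooth fields along g : A -> M.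
   The values of D outside A, or on non-smooth fields, are left unspecified. *)
Record is_covariant_derivative (nabla : (M -> E) -> (M -> E) -> M -> E) A g
    (D : (R -> E) -> R -> E) : Prop := IsCovariantDerivative {
  covD_smooth : forall Y, smooth_along A g Y -> smooth_along A g (D Y);
  covDD : forall Y Z, smooth_along A g Y -> smooth_along A g Z ->
    forall t, A t -> D (fun s => Y s + Z s) t = D Y t + D Z t;
  covD_leibniz : forall (f : R -> R) Y,
    smooth_within A f -> smooth_along A g Y ->
    forall t, A t -> D (fun s => f s *: Y s) t =
      deriv_within A f t *: Y t + f t *: D Y t;
  covD_extendible : forall X Y, smooth_field X ->
    (forall t, A t -> Y t = X (g t)) ->
    forall t, A t -> forall Z, smooth_field Z -> Z (g t) = velocity A g t ->
      D Y t = nabla Z X (g t) }.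

Definition covD (nabla : (M -> E) -> (M -> E) -> M -> E) A g :
    (R -> E) -> R -> E :=
  xget (fun _ _ => 0) [set D | is_covariant_derivative nabla A g D].

Definition Omega (a b : R) (qa : M) (va : E) (qb : M) (vb : E) : set (R -> M) :=
  [set g | [/\ C1_curve `[a, b] g, piecewise_smooth_curve a b g,
               g a = qa /\ velocity `[a, b] g a = va &
               g b = qb /\ velocity `[a, b] g b = vb]].

End Curves.
End Manifolds.

HB.mixin Record isLieGroup (R : realType) (n : nat) G
    of Group G & Manifold R n G := {
  mulg_smooth : smooth_map2 (fun g h : G => (g * h)%g);
  invg_smooth : smooth_map (fun g : G => (g^-1)%g) }.

#[short(type="lieGroupType")]
HB.structure Definition LieGroup (R : realType) (n : nat) :=
  {G of Group G & Manifold R n G & isLieGroup R n G}.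

Section LieGroups.
Context {R : realType} {n : nat} {G : lieGroupType R n}.
Local Notation E := 'rV[R]_n.

Definition Ltrans (g : G) : G -> G := fun h => (g * h)%g.
Definition Rtrans (g : G) : G -> G := fun h => (h * g)%g.

Definition bi_invariant (met : G -> E -> E -> R) :=
  forall (g p : G) (u v : E),
    met (Ltrans g p) (tmap (Ltrans g) p u) (tmap (Ltrans g) p v) = met p u v /\
    met (Rtrans g p) (tmap (Rtrans g) p u) (tmap (Rtrans g) p v) = met p u v.

Definition left_field (u : E) : G -> E := fun g => tmap (Ltrans g) (1%g : G) u.

Definition lie_bracket (u v : E) : E :=
  bracket (left_field u) (left_field v) (1%g : G).

Definition left_velocity (A : set R) (g : R -> G) : R -> E :=
  fun t => tmap (Ltrans (g t)^-1%g) (g t) (velocity A g t).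

Definition solves_second_order (met : G -> E -> E -> R)
    (nabla : (G -> E) -> (G -> E) -> G -> E) (V : G -> R) (a b : R)
    (g : R -> G) :=
  let I := `[a, b]%classic in
  let D := covD nabla I g in
  let dg := velocity I g in
  smooth_curve I g /\
  forall t, I t ->
    D (D (D dg)) t + curvature nabla (g t) (D dg t) (dg t) (dg t)
      + grad met V (g t) = 0.

Definition solves_reduced (met : G -> E -> E -> R) (Vext : G -> G -> R)
    (a b : R) (xi : R -> E) (h : R -> G) :=
  let I := `[a, b]%classic in
  [/\ smooth_within I xi, smooth_curve I h &
    forall t, I t ->
      derivn_within I 3 xi t + lie_bracket (xi t) (derivn_within I 2 xi t)
        + tmap (Ltrans (h t)^-1%g) (h t) (grad met (Vext ^~ 1%g) (h t)) = 0
      /\ velocity I h t = tmap (Ltrans (h t)) 1%g (xi t)].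

End LieGroups.

(* Main.v *)
(** The left-invariant fields E_i form a global frame of G, so every field is a
    combination of the E_i with globally smooth coefficients; the connection,
    the curvature and D_t are thus determined by their values on the frame.
    Bi-invariance makes the adjoint representation skew, and Koszul's formula
    then gives nabla_X Y = [X, Y] / 2 on left-invariant fields. Consequently, in
    the left trivialisation, D_t y = y' + [xi, y] / 2 and
    R(x, y)z = [x, [y, z]] / 4 - [y, [x, z]] / 4 - [[x, y], z] / 2.
    For y = xi this yields D_t^3 g' = xi''' + [xi, xi''] + [xi, [xi, xi']] / 4,
    whose last term is cancelled by R(xi', xi)xi = - [xi, [xi, xi']] / 4.
    Finally, the left translation by g0^-1 is an isometry carrying V to
    Vext(_, e), so it carries grad V to the gradient of Vext(_, e). *)

Require Import Defs.
From HB Require Import structures.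
From mathcomp Require Import all_boot all_order all_algebra.
From mathcomp Require Import all_classical all_reals topology normedtype landau
  derive numfun.
From mathcomp Require Import ring lra.

Set Implicit Arguments.
Unset Strict Implicit.
Unset Printing Implicit Defensive.

Import Order.TTheory GRing.Theory Num.Theory.
Import numFieldNormedType.Exports.

Local Open Scope classical_set_scope.
Local Open Scope ring_scope.

(** Three features of the definitions shape the proof. A tangent vector at p is a coordinate vector
    in [chart_at p], and this chart may jump as p varies, so that neither a field nor a velocity can
    be differentiated as it stands. It is first read in a fixed chart or through the left
    trivialisation [ltriv], which turns smooth fields on G and along g into smooth functions with
    values in one fixed vector space. Next, derivatives along a curve are relative to [a, b], hence
    one-sided at the end points, whereas those in charts are two-sided; the rules needed in both
    settings are derived once, in an abstract calculus. Finally, [covD], [curvature] and [grad] are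
    chosen by [xget]. For [covD] an operator with the characteristic properties has to be exhibited
    and shown to be unique on smooth fields; for [curvature] all extensions of the three vectors
    have to give the same value; [grad] is compared across a translation without presupposing that a
    representing vector exists. *)

Lemma scale_bilinear (R : realType) (W : normedModType R) :
  bilinear_for (GRing.Scale.Law.clone _ _ *:%R _)
    (GRing.Scale.Law.clone _ _ *:%R _) (@GRing.scale R W).
Proof.
split=> [u'|u] a x y /=.
- by rewrite scalerDl scalerA.
- by rewrite scalerDr !scalerA mulrC.
Qed.

HB.instance Definition _ (R : realType) (W : normedModType R) :=
  bilinear_isBilinear.Build R R W W _ _ (@GRing.scale R W)
    (@scale_bilinear R W).

(** * Differentials of scaling and addition *)

Section Scale.
Context {R : realType} {W : normedModType R}.
Implicit Types p : R * W.

Lemma differentiable_scale p :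
  differentiable (fun q : R * W => q.1 *: q.2) p.
Proof. by apply: differentiable_bilin => ?; exact: scale_continuous. Qed.

Lemma diff_scale p q : 'd (fun q : R * W => q.1 *: q.2) p q =
  p.1 *: q.2 + q.1 *: p.2.
Proof. by rewrite diff_bilin// => ?; exact: scale_continuous. Qed.

(** The linear structure is packed inside the proof, so that bare functions such as
    [fun r => r *: v] or a partially applied bilinear map can be differentiated. *)
Lemma is_diff_linear (V' W' : normedModType R) (f : V' -> W') x :
  linear f -> continuous f -> is_diff x f f.
Proof.
move=> lin fc.
pose fM := GRing.isLinear.Build _ _ _ _ _ lin.
pose fL : {linear V' -> W'} := HB.pack f fM.
apply: DiffDef; rewrite -[f]/(fL : _ -> _).
- exact: linear_differentiable.
- by rewrite diff_lin.
Qed.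

Let is_diff_add (z : W * W) :
  is_diff z (fun q : W * W => q.1 + q.2) (fun q => q.1 + q.2).
Proof.
apply: is_diff_linear; first by move=> a x y /=; rewrite scalerDr addrACA.
by move=> q; exact: add_continuous.
Qed.

Lemma differentiable_add (z : W * W) :
  differentiable (fun q : W * W => q.1 + q.2) z.
Proof. exact: (@ex_diff _ _ _ _ _ _ _ (is_diff_add z)). Qed.

Lemma diff_add (z q : W * W) : 'd (fun q : W * W => q.1 + q.2) z q = q.1 + q.2.
Proof. by rewrite (@diff_val _ _ _ _ _ _ _ (is_diff_add z)). Qed.

End Scale.

(* An abstract differential calculus, with two instances: functions on an open
   set with their directional derivatives, and functions of one real variable
   with their derivatives relative to a set. *)
Record dcalc (R : realType) := DCalc {
  dpt :> Type;
  ddom : set dpt;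
  dnear : dpt -> set_system dpt;
  ddir : Type;
  dif : forall W : normedModType R, (dpt -> W) -> dpt -> Prop;
  der : forall W : normedModType R, ddir -> (dpt -> W) -> dpt -> W;
  dnear_filter : forall t, Filter (dnear t);
  dnear_point : forall t P, ddom t -> dnear t P -> P t;
  dnear_near : forall t P, dnear t P -> dnear t (fun s => dnear s P);
  dnear_dom : forall t, dnear t ddom;
  dif_continuous : forall (W : normedModType R) (f : dpt -> W) t,
    ddom t -> dif f t -> f @ dnear t --> f t;
  dif_cst : forall (W : normedModType R) (w : W) t, dif (fun=> w) t;
  der_cst : forall (W : normedModType R) (w : W) v t,
    ddom t -> der v (fun=> w) t = 0;
  dif_eq : forall (W : normedModType R) (f g : dpt -> W) t, ddom t ->
    dnear t (fun s => f s = g s) -> dif f t -> dif g t;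
  der_eq : forall (W : normedModType R) (f g : dpt -> W) v t, ddom t ->
    dnear t (fun s => f s = g s) -> dif f t -> der v f t = der v g t;
  dif_comp : forall (W W' : normedModType R) (f : dpt -> W) (F : W -> W') t,
    ddom t -> dif f t -> differentiable F (f t) -> dif (fun s => F (f s)) t;
  der_comp : forall (W W' : normedModType R) (f : dpt -> W) (F : W -> W') v t,
    ddom t -> dif f t -> differentiable F (f t) ->
    der v (fun s => F (f s)) t = 'd F (f t) (der v f t);
  dif_pair : forall (W W' : normedModType R) (f : dpt -> W) (g : dpt -> W') t,
    ddom t -> dif f t -> dif g t -> dif (fun s => (f s, g s)) t;
  der_pair : forall (W W' : normedModType R) (f : dpt -> W) (g : dpt -> W') v t,
    ddom t -> dif f t -> dif g t ->
    der v (fun s => (f s, g s)) t = (der v f t, der v g t) }.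

#[global] Existing Instance dnear_filter.

(** * Iterated differentiability in an abstract calculus *)

Section Ck.
Context {R : realType} {C : dcalc R}.
Implicit Types (W : normedModType R) (t : C) (k : nat).

(** The pair (a, f) is composed with the fixed differentiable map (c, w) |-> c w. All algebraic
    rules arise in this way, so the calculus itself only needs pairing and a chain rule. *)
Lemma dif_scale W (a : C -> R) (f : C -> W) t : ddom t ->
  dif a t -> dif f t -> dif (fun s => a s *: f s) t.
Proof.
move=> tD da df; have dp := dif_pair tD da df.
exact: (dif_comp tD dp (differentiable_scale _)).
Qed.

Lemma der_scale W (a : C -> R) (f : C -> W) v t : ddom t ->
  dif a t -> dif f t ->
  der v (fun s => a s *: f s) t = a t *: der v f t + der v a t *: f t.
Proof.
move=> tD da df; have dp := dif_pair tD da df.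
by rewrite (der_comp v tD dp (differentiable_scale _)) diff_scale der_pair.
Qed.

Lemma difD W (f g : C -> W) t : ddom t ->
  dif f t -> dif g t -> dif (fun s => f s + g s) t.
Proof.
move=> tD df dg; have dp := dif_pair tD df dg.
exact: (dif_comp tD dp (differentiable_add _)).
Qed.

Lemma derD W (f g : C -> W) v t : ddom t ->
  dif f t -> dif g t -> der v (fun s => f s + g s) t = der v f t + der v g t.
Proof.
move=> tD df dg; have dp := dif_pair tD df dg.
by rewrite (der_comp v tD dp (differentiable_add _)) diff_add der_pair.
Qed.

Lemma dif_lin W W' (L : {linear W -> W'}) (f : C -> W) t : continuous L ->
  ddom t -> dif f t -> dif (fun s => L (f s)) t.
Proof.
by move=> Lc tD df; apply: dif_comp => //; exact: linear_differentiable.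
Qed.

Lemma der_lin W W' (L : {linear W -> W'}) (f : C -> W) v t : continuous L ->
  ddom t -> dif f t -> der v (fun s => L (f s)) t = L (der v f t).
Proof.
move=> Lc tD df; rewrite der_comp ?diff_lin//; exact: linear_differentiable.
Qed.

Lemma dif_sum W m (f : 'I_m -> C -> W) t : ddom t ->
  (forall i, dif (f i) t) -> dif (fun s => \sum_i f i s) t.
Proof.
move=> tD; elim: m f => [|m IH] f df.
  by under eq_fun do rewrite big_ord0; exact: dif_cst.
by under eq_fun do rewrite big_ord_recl; apply: difD => //; exact: IH.
Qed.

Lemma der_sum W m (f : 'I_m -> C -> W) v t : ddom t ->
  (forall i, dif (f i) t) ->
  der v (fun s => \sum_i f i s) t = \sum_i der v (f i) t.
Proof.
move=> tD; elim: m f => [|m IH] f df.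
  by under eq_fun do rewrite big_ord0; rewrite der_cst// big_ord0.
under eq_fun do rewrite big_ord_recl.
by rewrite derD// ?big_ord_recl ?IH//; exact: dif_sum.
Qed.

(** Differentiability is required near t and not only at t, so that the derivatives are functions
    that can be differentiated again. Mind the shift: [Ck k] says that the derivatives of order at
    most k are differentiable near t. *)
Fixpoint Ck k W (f : C -> W) t : Prop :=
  dnear t (fun s => dif f s) /\
  if k is k'.+1 then forall v, Ck k' (der v f) t else True.

Definition smooth_near W (f : C -> W) t := forall k, Ck k f t.

Lemma Ck_near k W (f : C -> W) t : Ck k f t -> dnear t (fun s => dif f s).
Proof. by case: k => [|k] []. Qed.

Lemma Ck_dif k W (f : C -> W) t : ddom t -> Ck k f t -> dif f t.
Proof. by move=> tD /Ck_near/dnear_point; exact. Qed.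

Lemma CkW k W (f : C -> W) t : Ck k.+1 f t -> Ck k f t.
Proof.
elim: k W f => [|k IH] W f [df Df]; split=> // v.
by apply: IH; exact: Df.
Qed.

Lemma Ck_eq k W (f g : C -> W) t :
  dnear t (fun s => f s = g s) -> Ck k f t -> Ck k g t.
Proof.
elim: k W f g => [|k IH] W f g fg [df Df]; split=> //.
- apply: filter_app (dnear_dom t); apply: filter_app df.
  by apply: filterS (dnear_near fg) => s fgs ? ?; exact: dif_eq fgs _.
- apply: filter_app (dnear_dom t); apply: filter_app df.
  by apply: filterS (dnear_near fg) => s fgs ? ?; exact: dif_eq fgs _.
- move=> v; apply: (IH _ (der v f)); last exact: Df.
  apply: filter_app (dnear_dom t); apply: filter_app df.
  by apply: filterS (dnear_near fg) => s fgs ? ?; exact: der_eq fgs _.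
Qed.

(** The explicit formula g for the derivatives need only hold near t, which is where the calculation
    rules apply. The inductions on k below all proceed through it. *)
Lemma Ck_step k W (f : C -> W) t (g : ddir C -> C -> W) :
  dnear t (fun s => dif f s) ->
  (forall v, dnear t (fun s => g v s = der v f s)) ->
  (forall v, Ck k (g v) t) -> Ck k.+1 f t.
Proof. by move=> df gf Ckg; split=> // v; exact: Ck_eq (gf v) _. Qed.

Lemma Ck_cst k W (w : W) t : Ck k (fun=> w) t.
Proof.
elim: k W w => [|k IH] W w; first by split=> //; apply: filterE => s;
  exact: dif_cst.
apply: (@Ck_step k _ _ _ (fun _ _ => 0)) => //.
- by apply: filterE => s; exact: dif_cst.
- by move=> v; apply: filterS (dnear_dom t) => s sD; rewrite der_cst.
Qed.

Lemma Ck_add k W (f g : C -> W) t :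
  Ck k f t -> Ck k g t -> Ck k (fun s => f s + g s) t.
Proof.
elim: k W f g => [|k IH] W f g [df Df] [dg Dg].
  split=> //; apply: filter_app (dnear_dom t); apply: filter_app df.
  by apply: filterS dg => s ? ? ?; exact: difD.
apply: (@Ck_step k _ _ _ (fun v s => der v f s + der v g s)).
- apply: filter_app (dnear_dom t); apply: filter_app df.
  by apply: filterS dg => s ? ? ?; exact: difD.
- move=> v; apply: filter_app (dnear_dom t); apply: filter_app df.
  by apply: filterS dg => s ? ? ?; rewrite derD.
- by move=> v; apply: IH; [exact: Df|exact: Dg].
Qed.

Lemma Ck_scale k W (a : C -> R) (f : C -> W) t :
  Ck k a t -> Ck k f t -> Ck k (fun s => a s *: f s) t.
Proof.
elim: k W a f => [|k IH] W a f Ca Cf; have := Ca; have := Cf;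
    move=> [df Df] [da Da].
  split=> //; apply: filter_app (dnear_dom t); apply: filter_app df.
  by apply: filterS da => s ? ? ?; exact: dif_scale.
apply: (@Ck_step k _ _ _ (fun v s => a s *: der v f s + der v a s *: f s)).
- apply: filter_app (dnear_dom t); apply: filter_app df.
  by apply: filterS da => s ? ? ?; exact: dif_scale.
- move=> v; apply: filter_app (dnear_dom t); apply: filter_app df.
  by apply: filterS da => s ? ? ?; rewrite der_scale.
(* Each term of the product rule pairs a derivative with an undifferentiated factor, whose order is
   lowered to k. *)
- move=> v; apply: Ck_add; apply: IH; [exact: CkW|exact: Df|exact: Da|].
  exact: CkW.
Qed.

Lemma Ck_sum k W m (f : 'I_m -> C -> W) t :
  (forall i, Ck k (f i) t) -> Ck k (fun s => \sum_i f i s) t.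
Proof.
elim: m f => [|m IH] f Cf.
  by under eq_fun do rewrite big_ord0; exact: Ck_cst.
by under eq_fun do rewrite big_ord_recl; apply: Ck_add => //; exact: IH.
Qed.

Lemma Ck_lin k W W' (L : {linear W -> W'}) (f : C -> W) t : continuous L ->
  Ck k f t -> Ck k (fun s => L (f s)) t.
Proof.
move=> Lc; elim: k f => [|k IH] f [df Df].
  split=> //; apply: filter_app (dnear_dom t).
  by apply: filterS df => s ? ?; exact: dif_lin.
apply: (@Ck_step k _ _ _ (fun v s => L (der v f s))).
- apply: filter_app (dnear_dom t).
  by apply: filterS df => s ? ?; exact: dif_lin.
- move=> v; apply: filter_app (dnear_dom t).
  by apply: filterS df => s ? ?; rewrite der_lin.
- by move=> v; apply: IH; exact: Df.
Qed.

Lemma Ck_pair k W W' (f : C -> W) (g : C -> W') t :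
  Ck k f t -> Ck k g t -> Ck k (fun s => (f s, g s)) t.
Proof.
elim: k f g => [|k IH] f g [df Df] [dg Dg].
  split=> //; apply: filter_app (dnear_dom t); apply: filter_app df.
  by apply: filterS dg => s ? ? ?; exact: dif_pair.
apply: (@Ck_step k _ _ _ (fun v s => (der v f s, der v g s))).
- apply: filter_app (dnear_dom t); apply: filter_app df.
  by apply: filterS dg => s ? ? ?; exact: dif_pair.
- move=> v; apply: filter_app (dnear_dom t); apply: filter_app df.
  by apply: filterS dg => s ? ? ?; rewrite der_pair.
- by move=> v; apply: IH; [exact: Df|exact: Dg].
Qed.

Lemma smooth_near_der W (f : C -> W) v t :
  smooth_near f t -> smooth_near (der v f) t.
Proof. by move=> Cf k; have [_] := Cf k.+1; exact. Qed.

End Ck.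

(** * The two instances of the calculus *)

Section Euclid.
Context {R : realType} (E : normedModType R).

(** The first order expansion of f at x is also one of g, and [diff_unique] identifies 'd g x with
    its linear part. *)
Lemma near_eq_differentiable (W : normedModType R) (f g : E -> W) x :
  (\forall y \near x, f y = g y) -> differentiable f x -> differentiable g x.
Proof.
move=> fg df.
have fgx : f x = g x := nbhs_singleton fg.
have gE : g \o shift x = cst (g x) + 'd f x +o_ (0 : E) id.
  apply/eqaddoP => e e0.
  have /eqaddoP/(_ e e0) := diff_locally df.
  have : \forall y \near (0 : E), f (y + x) = g (y + x).
    by move: fg; rewrite (near_shift 0) subr0.
  apply: filterS2 => y fgy.
  rewrite -[(_ \o _ - _) _]/(f (y + x) - (f x + 'd f x y)).
  by rewrite -[(_ \o _ - _) _]/(g (y + x) - (g x + 'd f x y)) fgy fgx.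
have dfc : continuous ('d f x) := diff_continuous df.
have dE : 'd g x = 'd f x :> (E -> W) by exact: diff_unique gE.
by apply/diff_locallyP; rewrite dE; split.
Qed.

Lemma euclid_dif_comp (W W' : normedModType R) (f : E -> W) (F : W -> W') x :
  setT x -> differentiable f x -> differentiable F (f x) ->
  differentiable (fun s => F (f s)) x.
Proof. by move=> _ df dF; exact: differentiable_comp. Qed.

(** Ended by [Defined], so that [dif] and [der] reduce to [differentiable] and 'D_v and general
    lemmas apply by conversion. *)
Definition euclid : dcalc R.
Proof.
refine (@DCalc R E setT (fun x => nbhs x) E
  (fun W f x => differentiable f x) (fun W v f x => 'D_v f x)
  _ _ _ _ _ _ _ _ _ _ _ _ _).
- by move=> x P _; exact: nbhs_singleton.
- by move=> x P; exact: nbhs_interior.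
- by move=> x; exact: filterT.
- by move=> W f x _ df; exact: differentiable_continuous.
- by move=> W w x; exact: differentiable_cst.
- by move=> W w v x _; exact: derive_cst.
- by move=> W f g x _; exact: near_eq_differentiable.
- by move=> W f g v x _ fg _; exact: near_eq_derive.
- exact: euclid_dif_comp.
- move=> W W' f F v x _ df dF.
  have dFf : differentiable (F \o f) x by exact: differentiable_comp.
  rewrite (deriveE v df) -/(F \o f) (deriveE v dFf).
  have -> := diff_comp df dF; reflexivity.
- by move=> W W' f g x _ df dg; exact: differentiable_pair.
- move=> W W' f g v x _ df dg.
  rewrite (deriveE v df) (deriveE v dg) (deriveE v (differentiable_pair df dg)).
  have -> := diff_pair df dg; reflexivity.
Defined.

End Euclid.

Section Within.
Context {R : realType} (A : set R).
Hypothesis perfectA : forall t, A t -> ProperFilter (within A t^').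

Lemma nbhs_within_dnbhs (t : R) (P : set R) :
  P t -> within A t^' P -> within A (nbhs t) P.
Proof.
move=> Pt H; have {}H : nbhs t (fun s => s != t -> A s -> P s) := H.
apply: filterS H => s Ps As.
by have [->//|st] := eqVneq s t; exact: Ps.
Qed.

Lemma dnbhs_within (t : R) (P : set R) : within A (nbhs t) P -> within A t^' P.
Proof.
move=> H; have {}H : nbhs t (fun s => A s -> P s) := H.
have : nbhs t (fun s => s != t -> A s -> P s) by apply: filterS H => s Ps _.
exact.
Qed.

Lemma within_dnbhsS (t : R) (P Q : set R) :
  (forall s, s != t -> A s -> P s -> Q s) ->
  within A t^' P -> within A t^' Q.
Proof.
move=> PQ H; have {}H : nbhs t (fun s => s != t -> A s -> P s) := H.
have : nbhs t (fun s => s != t -> A s -> Q s).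
  by apply: filterS H => s Ps st As; apply: PQ => //; exact: Ps.
exact.
Qed.

Lemma within_dnbhsS2 (t : R) (P P' Q : set R) :
  (forall s, s != t -> A s -> P s -> P' s -> Q s) ->
  within A t^' P -> within A t^' P' -> within A t^' Q.
Proof.
move=> PQ HP HP'; apply: within_dnbhsS (filterI HP HP') => s st As [].
exact: PQ.
Qed.

Lemma cvg_within_subr (t : R) : (fun s => s - t) @ within A t^' --> (0 : R).
Proof.
have : (fun s => s - t) @ t --> (0 : R).
  by rewrite -[X in _ --> X](subrr t); apply: cvgB => //; exact: cvg_cst.
move=> H P P0; apply: dnbhs_within.
by apply: (@filterS _ (nbhs t)) (H P P0) => s Ps _.
Qed.

(** By [perfectA] every point of A is a limit point of A, and this makes limits of difference
    quotients unique. *)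
Lemma deriv_withinE (W : normedModType R) (f : R -> W) t (l : W) : A t ->
  dquot A f t --> l -> deriv_within A f t = l.
Proof. by move=> At; have ? := perfectA At; exact: cvg_lim. Qed.

(** Away from t, f s is f t plus (s - t) times the difference quotient, and this product tends to 0
    times l. *)
Lemma dquot_continuous (W : normedModType R) (f : R -> W) t (l : W) :
  dquot A f t --> l -> f @ within A (nbhs t) --> f t.
Proof.
move=> fl P Pft; apply: nbhs_within_dnbhs.
  exact: (nbhs_singleton Pft).
have : (fun s => (s - t) *: ((s - t)^-1 *: (f s - f t)) + f t) @ within A t^'
    --> f t.
  rewrite -[X in _ --> X]add0r -(scale0r l); apply: cvgD; last exact: cvg_cst.
  by apply: cvgZ => //; exact: cvg_within_subr.
move=> /(_ P Pft) H; apply: within_dnbhsS H => s st As /=.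
by rewrite scalerA mulfV ?subr_eq0// scale1r subrK.
Qed.

Lemma dquot_eq (W : normedModType R) (f g : R -> W) t : A t ->
  within A (nbhs t) (fun s => f s = g s) -> dquot A f t = dquot A g t.
Proof.
move=> At fg; have fgt : f t = g t := nbhs_singleton fg At.
rewrite eqEsubset; split => P; rewrite /dquot/= => H.
- by apply: within_dnbhsS2 (dnbhs_within fg) H => s st As /= ->; rewrite -fgt.
- by apply: within_dnbhsS2 (dnbhs_within fg) H => s st As /= ->; rewrite fgt.
Qed.

(** With e the remainder of F at f t, the quotient of F o f is 'd F applied to the quotient q of f,
    plus e (f s - f t) / (s - t). The last term tends to 0 because e is little-o and q is bounded
    near t. *)
Lemma dquot_comp (W W' : normedModType R) (f : R -> W) (F : W -> W') t (l : W) :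
  A t -> dquot A f t --> l -> differentiable F (f t) ->
  dquot A (fun s => F (f s)) t --> 'd F (f t) l.
Proof.
move=> At dfl dF; have ? := perfectA At.
pose q : R -> W := fun s => (s - t)^-1 *: (f s - f t).
have fl : q @ within A t^' --> l := dfl.
pose e : W -> W' := fun h => F (h + f t) - F (f t) - 'd F (f t) h.
have eo eps : 0 < eps -> \forall h \near 0, `|e h| <= eps * `|h|.
  move=> eps0; have /eqaddoP/(_ eps eps0) := diff_locally dF.
  apply: filterS => h; rewrite /e -addrA -opprD.
  by rewrite -[(_ \o _ - _) _]/(F (h + f t) - (F (f t) + 'd F (f t) h)).
have ft0 : (fun s => f s - f t) @ within A t^' --> (0 : W).
  have : (fun s => f s - f t) @ within A (nbhs t) --> (0 : W).
    rewrite -[X in _ --> X](subrr (f t)).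
    by apply: cvgB; [exact: dquot_continuous fl|exact: cvg_cst].
  by move=> H P P0; apply: dnbhs_within; exact: H.
have e0 : (fun s => (s - t)^-1 *: e (f s - f t)) @ within A t^' --> (0 : W').
  apply/cvgr0Pnorm_le => eps eps0.
  (* Adding 1 makes M positive and strictly larger than the norm of the limit l, so that |q s| <= M
     near t. *)
  pose M := `|l| + 1.
  have M0 : 0 < M by rewrite ltr_wpDl.
  have := eo _ (divr_gt0 eps0 M0) => /ft0; rewrite nearE.
  have : within A t^' (fun s => `|q s| <= M).
    have Ml : `|l| < M by rewrite /M ltrDl.
    exact: (@cvgr_norm_le _ W _ _ _ _ _ fl M Ml).
  move=> H1 H2; apply: within_dnbhsS2 H2 H1 => s st As H2 H1; rewrite normrZ.
  apply: le_trans (ler_wpM2l _ H2) _ => //.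
  rewrite mulrCA -normrZ; apply: le_trans (ler_wpM2l _ H1) _.
    by rewrite ltW// divr_gt0.
  by rewrite divfK// gt_eqF.
have dFl : (fun s => 'd F (f t) (q s)) @ within A t^' -->
    'd F (f t) l.
  have dFc : continuous ('d F (f t)) := diff_continuous dF.
  exact: (continuous_cvg _ (dFc l) fl).
rewrite -[X in _ --> X]addr0.
apply: cvg_trans (cvgD dFl e0).
apply: near_eq_cvg; rewrite nearE; apply: filterE => s.
transitivity ('d F (f t) (q s) + (s - t)^-1 *: e (f s - f t)); first by [].
rewrite /e subrK /q linearZ -scalerDr; congr (_ *: _).
by rewrite addrC subrK.
Qed.

Lemma dquot_pair (W W' : normedModType R) (f : R -> W) (g : R ->
  W') t (l : W) (l' : W') :
  dquot A f t --> l -> dquot A g t --> l' ->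
  dquot A (fun s => (f s, g s)) t --> (l, l').
Proof.
move=> fl gl.
pose p : R -> W := fun s => (s - t)^-1 *: (f s - f t).
pose q : R -> W' := fun s => (s - t)^-1 *: (g s - g t).
have {}fl : p @ within A t^' --> l := fl.
have {}gl : q @ within A t^' --> l' := gl.
exact: (cvg_pair fl gl).
Qed.

(** There is only one direction, whence [unit]. The neighbourhoods in A keep the point t itself,
    unlike the punctured ones of the difference quotients, so that properties holding near t hold at
    t. *)
Definition curve_calc : dcalc R.
Proof.
refine (@DCalc R R A (fun t => within A (nbhs t)) unit
  (fun W f t => derivable_within A f t) (fun W _ f t => deriv_within A f t)
  _ _ _ _ _ _ _ _ _ _ _ _ _).
- by move=> x P Ax /nbhs_singleton; exact.
- move=> x P /nbhs_interior; apply: filterS => s H _; exact: H.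
- by move=> x; exact: withinT.
- by move=> W f x Ax df; apply: dquot_continuous; exact: df.
- move=> W w t; apply/cvg_ex; exists 0; rewrite /dquot.
  by under eq_fun do rewrite subrr scaler0; exact: cvg_cst.
- move=> W w v t At; apply: deriv_withinE => //; rewrite /dquot.
  by under eq_fun do rewrite subrr scaler0; exact: cvg_cst.
- by move=> W f g t At fg; rewrite /derivable_within (dquot_eq At fg).
- by move=> W f g v t At fg _; rewrite /deriv_within (dquot_eq At fg).
- move=> W W' f F t At df dF; apply/cvg_ex.
  by eexists; apply: dquot_comp dF => //; exact: df.
- move=> W W' f F v t At df dF; apply: deriv_withinE => //.
  by apply: dquot_comp dF.
- move=> W W' f g t At df dg; apply/cvg_ex; eexists.
  by apply: dquot_pair; [exact: df|exact: dg].
- move=> W W' f g v t At df dg; apply: deriv_withinE => //.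
  by apply: dquot_pair.
Defined.

End Within.

(** * Symmetry of second derivatives *)

Section Schwarz.
Context {R : realType} {E : normedModType R}.
Implicit Types (f : E -> R) (x v w : E).

Lemma is_derive_along f v z s : differentiable f (s *: v + z) ->
  is_derive s (1 : R) (fun r : R => f (r *: v + z)) ('D_v f (s *: v + z)).
Proof.
move=> df.
have dl : is_diff s (fun r : R => r *: v + z) (fun r => r *: v).
  have d1 : is_diff s (fun r : R => r *: v) (fun r => r *: v).
    apply: is_diff_linear; last exact: scalel_continuous.
    by move=> a b c; rewrite scalerDl scalerA.
  have d2 := is_diff_cst z s.
  have [dD dE] := is_diffD d1 d2.
  split; first exact: dD.
  by apply: etrans dE _; apply/funext => r; rewrite -[LHS]/(r *: v + 0) addr0.
have df' : is_diff (s *: v + z) f ('d f (s *: v + z)) by exact: differentiableP.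
have := is_diff_comp dl df' => dc.
have dfc : differentiable (fun r : R => f (r *: v + z)) s by case: dc.
split; first exact/derivable1_diffP.
rewrite deriveE//; apply: etrans (congr1 (@^~ 1) (@diff_val _ _ _ _ _ _ _ dc))
  _.
by rewrite (deriveE v df) /= scale1r.
Qed.

(** The second difference of f at x. Its symmetry in v and w is the source of the symmetry of second
    derivatives. *)
Let Delta f x v w (h : R) :=
  f (h *: v + (h *: w + x)) - f (h *: v + x) - f (h *: w + x) + f x.

(* Mean value theorem for s |-> f (x + s v + h w) - f (x + s v), followed by a
   first order expansion of 'D_v f at x. *)
Let Delta_bound f x v w : (\forall y \near x, differentiable f y) ->
  differentiable ('D_v f) x -> forall e : R, 0 < e ->
  \forall h \near 0^'+, `|Delta f x v w h - h ^+ 2 * 'D_w ('D_v f) x| <=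
     e * (`|v| + `|w| + `|v|) * h ^+ 2.
Proof.
move=> df dDf e e0.
pose d := 'd ('D_v f) x.
have : \forall k \near (0 : E), differentiable f (k + x) /\
    `|'D_v f (k + x) - 'D_v f x - d k| <= e * `|k|.
  apply: filterI; first by move: df; rewrite (near_shift 0) subr0.
  have /eqaddoP/(_ e e0) := diff_locally dDf.
  by apply: filterS => k; rewrite -addrA -opprD.
move=> /nbhs_ballP[r /= r0 rP].
(* For h < r / M all points x + s v + t w with s and t in [0, h] stay in the ball of radius r; the
   summand 1 keeps M positive. *)
pose M := `|v| + `|w| + 1.
have M0 : 0 < M by rewrite ltr_wpDl// addr_ge0.
have ball_r (s t h : R) : 0 <= s <= h -> 0 <= t <= h -> h < r / M ->
    `|s *: v + t *: w| <= h * (`|v| + `|w|) /\ ball 0 r (s *: v + t *: w).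
  move=> /andP[s0 sh] /andP[t0 th] hr.
  have h0 : 0 <= h by exact: le_trans sh.
  have le1 : `|s *: v + t *: w| <= h * (`|v| + `|w|).
    rewrite (le_trans (ler_normD _ _))// !normrZ !ger0_norm// mulrDr.
    by rewrite lerD// ler_wpM2r.
  split=> //; rewrite -ball_normE /ball_/= sub0r normrN.
  apply: le_lt_trans le1 _; apply: (@le_lt_trans _ _ (h * M)).
    by rewrite ler_wpM2l// /M lerDl.
  by rewrite -ltr_pdivlMr.
near=> h.
have h0 : 0 < h by [].
have hr : h < r / M by near: h; apply: nbhs_right_lt; rewrite divr_gt0.
pose psi (s : R) := f (s *: v + (h *: w + x)) - f (s *: v + x).
pose dpsi (s : R) := 'D_v f (s *: v + (h *: w + x)) - 'D_v f (s *: v + x).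
have rD s t : 0 <= s <= h -> 0 <= t <= h -> differentiable f (s *: v + (t *: w
  + x)).
  by move=> sh th; rewrite addrA; apply: (rP _ (ball_r s t h sh th hr).2).1.
have psi' s : 0 <= s <= h -> is_derive s 1 psi (dpsi s).
  move=> sh; apply: is_deriveB; apply: is_derive_along.
    by apply: rD => //; rewrite lexx ltW.
  by rewrite -[x]add0r -[0](scale0r w); apply: rD => //; rewrite lexx ltW.
have [|||c] := @MVT R psi dpsi 0 h.
- by [].
- by move=> s; rewrite in_itv/= => /andP[? ?]; apply: psi'; rewrite !ltW.
- apply: derivable_within_continuous => s; rewrite in_itv/= => sh.
  by have [] := psi' s sh.
rewrite in_itv/= => /andP[c0 ch]; rewrite subr0 => psiE.
have -> : Delta f x v w h = h * dpsi c.
  rewrite mulrC -psiE /psi /Delta !scale0r !add0r; lra.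
have cI : 0 <= c <= h by rewrite !ltW.
have hI : 0 <= h <= h by rewrite lexx ltW.
have zI : 0 <= (0 : R) <= h by rewrite lexx ltW.
have [n1 b1] := ball_r _ _ _ cI hI hr.
have [n2 b2] := ball_r _ _ _ cI zI hr.
have [_ e1] := rP _ b1; have [_ e2] := rP _ b2.
have -> : 'D_w ('D_v f) x = d w by rewrite deriveE.
set o1 := 'D_v f (c *: v + h *: w + x) - _ - _ in e1.
set o2 := 'D_v f (c *: v + 0 *: w + x) - _ - _ in e2.
have -> : dpsi c = h * d w + (o1 - o2).
  rewrite /dpsi /o1 /o2 scale0r addr0 [d (_ + _)]linearD [d (h *: w)]linearZ.
  rewrite (addrA (c *: v)).
  have ac (A B D F H : R) : A - B = H + (A - D - (F + H) - (B - D - F)) by lra.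
  exact: ac.
have {}e1 : `|o1| <= e * (h * (`|v| + `|w|)).
  by apply: le_trans e1 _; rewrite ler_wpM2l// ltW.
have {}e2 : `|o2| <= e * (h * `|v|).
  apply: le_trans e2 _; apply: ler_wpM2l; first exact: ltW.
  rewrite scale0r addr0 normrZ ger0_norm; last exact: ltW.
  by apply: ler_wpM2r => //; exact: ltW.
have -> : h * (h * d w + (o1 - o2)) - h ^+ 2 * d w = h * (o1 - o2).
  have ac (D o : R) : h * (h * D + o) - h ^+ 2 * D = h * o by ring.
  exact: ac.
rewrite normrM (ger0_norm (ltW h0)).
apply: le_trans (ler_wpM2l (ltW h0) (le_trans (ler_normB _ _) (lerD e1 e2))) _.
by rewrite le_eqVlt; apply/orP; left; apply/eqP; ring.
Unshelve. all: by end_near. Qed.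

(** Both mixed derivatives, multiplied by h ^+ 2, approximate the same second difference. With M
    above the sum of the two error constants, the tolerance e / M bounds their distance by e. *)
Lemma derive_comm f x v w : (\forall y \near x, differentiable f y) ->
  differentiable ('D_v f) x -> differentiable ('D_w f) x ->
  'D_w ('D_v f) x = 'D_v ('D_w f) x.
Proof.
move=> df dv dw; apply/eqP; rewrite -subr_eq0 -normr_le0.
apply/ler_addgt0Pr => e e0; rewrite add0r.
pose M := (`|v| + `|w| + `|v|) + (`|w| + `|v| + `|w|) + 1.
have M0 : 0 < M by rewrite ltr_wpDl// !addr_ge0.
have eM : 0 < e / M by rewrite divr_gt0.
have QM : (`|v| + `|w| + `|v|) + (`|w| + `|v| + `|w|) <= M by rewrite lerDl.
have H1 := Delta_bound w df dv eM.
have H2 := Delta_bound v df dw eM.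
near (0 : R)^'+ => h.
have h0 : 0 < h by [].
have h2 : 0 < h ^+ 2 by rewrite exprn_gt0.
rewrite -(ler_pM2r h2) -[X in _ * X <= _](ger0_norm (ltW h2)) -normrM.
have B1 : `|Delta f x v w h - h ^+ 2 * 'D_w ('D_v f) x| <=
    e / M * (`|v| + `|w| + `|v|) * h ^+ 2 by near: h.
have B2 : `|Delta f x w v h - h ^+ 2 * 'D_v ('D_w f) x| <=
    e / M * (`|w| + `|v| + `|w|) * h ^+ 2 by near: h.
have DE : Delta f x w v h = Delta f x v w h.
  by rewrite /Delta addrCA [_ - f (h *: w + x) - _]addrAC.
rewrite DE in B2.
have -> : ('D_w ('D_v f) x - 'D_v ('D_w f) x) * h ^+ 2 =
    (Delta f x v w h - h ^+ 2 * 'D_v ('D_w f) x) -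
    (Delta f x v w h - h ^+ 2 * 'D_w ('D_v f) x).
  have ac (A B D : R) : (A - B) * h ^+ 2 = D - h ^+ 2 * B - (D - h ^+ 2 * A).
    by ring.
  exact: ac.
apply: le_trans (ler_normB _ _) _; apply: le_trans (lerD B2 B1) _.
rewrite -mulrDl; apply: ler_wpM2r; first exact: ltW.
rewrite -mulrDr -mulrA; apply: (@le_trans _ _ (e * 1)); last by rewrite mulr1.
apply: ler_wpM2l; first exact: ltW.
rewrite mulrC ler_pdivrMr// mul1r addrC.
exact: QM.
Unshelve. all: by end_near. Qed.

End Schwarz.

(** * Coordinates and composition of smooth functions *)

Record frame (R : realType) (E : normedModType R) := Frame {
  fdim : nat;
  fvec : 'I_fdim -> E;
  fcoord : 'I_fdim -> {linear E -> R};
  fcoord_continuous : forall i, continuous (fcoord i);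
  frame_eq : forall x, x = \sum_i fcoord i x *: fvec i }.

Arguments fvec {R E} _ _.
Arguments fcoord {R E} _ _.
Arguments frame_eq {R E} _ _.

Section Coord.
Context {R : realType} {n : nat}.
Local Notation E := 'rV[R]_n.

Definition rv_coord (i : 'I_n) (x : E) : R := x 0 i.

Lemma coord_is_linear i : linear (rv_coord i).
Proof. by move=> a x y; rewrite /rv_coord !mxE. Qed.

HB.instance Definition _ i :=
  GRing.isLinear.Build R E R _ (rv_coord i) (coord_is_linear i).

Lemma coord_is_continuous i : continuous (rv_coord i).
Proof. exact: coord_continuous. Qed.

Definition rv_vec (i : 'I_n) : E := delta_mx 0 i.

Lemma rv_sum (x : E) : x = \sum_i rv_coord i x *: rv_vec i.
Proof. exact: row_sum_delta. Qed.

Definition rv_frame : frame E := Frame coord_is_continuous rv_sum.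

Definition coord2 (i : 'I_n + 'I_n) (z : E * E) : R :=
  match i with inl i => rv_coord i z.1 | inr i => rv_coord i z.2 end.

Lemma coord2_is_linear i : linear (coord2 i).
Proof. by case: i => i a x y; rewrite /coord2 /rv_coord !mxE. Qed.

HB.instance Definition _ i :=
  GRing.isLinear.Build R (E * E)%type R _ (coord2 i) (coord2_is_linear i).

Lemma coord2_continuous i : continuous (coord2 i).
Proof.
case: i => i z; rewrite /coord2.
- exact: (continuous_comp (@cvg_fst _ _ _ _ _) (@coord_is_continuous i z.1)).
- exact: (continuous_comp (@cvg_snd _ _ _ _ _) (@coord_is_continuous i z.2)).
Qed.

Definition vec2 (i : 'I_n + 'I_n) : E * E :=
  match i with inl i => (rv_vec i, 0) | inr i => (0, rv_vec i) end.

Lemma rv2_sum (z : E * E) :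
  z = \sum_(i < n + n) coord2 (fintype.split i) z *: vec2 (fintype.split i).
Proof.
rewrite big_split_ord/=.
under eq_bigr do rewrite (unsplitK (inl _)) /=.
under [X in _ + X]eq_bigr do rewrite (unsplitK (inr _)) /=.
have pl (s : 'I_n -> E) : \sum_i ((s i, 0) : E * E) = (\sum_i s i, 0).
  by elim/big_rec2: _ => // i x y _ ->; rewrite -[LHS]/(_ + _, 0 + 0) addr0.
have pr (s : 'I_n -> E) : \sum_i ((0, s i) : E * E) = (0, \sum_i s i).
  by elim/big_rec2: _ => // i x y _ ->; rewrite -[LHS]/(0 + 0, _ + _) addr0.
have -> : \sum_i rv_coord i z.1 *: ((rv_vec i, 0) : E * E) = (z.1, 0).
  rewrite [in RHS](rv_sum z.1) -pl; apply: eq_bigr => i _.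
  by rewrite -[LHS]/(_ *: _, _ *: 0) scaler0.
have -> : \sum_i rv_coord i z.2 *: ((0, rv_vec i) : E * E) = (0, z.2).
  rewrite [in RHS](rv_sum z.2) -pr; apply: eq_bigr => i _.
  by rewrite -[LHS]/(_ *: 0, _ *: _) scaler0.
by case: z => x y; rewrite -[RHS]/(x + 0, 0 + y) addr0 add0r.
Qed.

Definition rv2_frame : frame (E * E)%type :=
  Frame (fun i : 'I_(n + n) => @coord2_continuous (fintype.split i)) rv2_sum.

Lemma rv_eq (x y : E) : (forall i, rv_coord i x = rv_coord i y) -> x = y.
Proof. by move=> xy; apply/rowP => i; exact: xy. Qed.

End Coord.

Section Comp.
Context {R : realType}.

Lemma diff_frame (E W : normedModType R) (fr : frame E) (F : E -> W) x v :
  differentiable F x ->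
  'd F x v = \sum_i fcoord fr i v *: 'D_(fvec fr i) F x.
Proof.
move=> dF; rewrite {1}(frame_eq fr v) linear_sum; apply: eq_bigr => i _.
by rewrite linearZ/= (deriveE _ dF).
Qed.

(** The derivative of F o f at s is 'd F (f s) in the direction der v f s, which varies with s. The
    frame rewrites it as a finite sum of coordinates of der v f times derivatives of F in fixed
    directions, and the induction hypothesis applies to the latter composed with f. *)
Lemma Ck_comp (C : dcalc R) (E : normedModType R) (fr : frame E) k
    (W : normedModType R) (f : C -> E) (F : E -> W) (t : C) : ddom t ->
  Ck k f t -> Ck (C := euclid E) k F (f t) -> Ck k (fun s => F (f s)) t.
Proof.
move=> tD; elim: k W F => [|k IH] W F Cf CF.
  have [df _] := Cf; have [dF _] := CF; split=> //.
  have := dif_continuous tD (dnear_point tD df) dF.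
  apply: filterS2 (filterI df (dnear_dom t)) => s [dfs sD] dFs.
  exact: dif_comp.
have [df Df] := Cf; have [dF DF] := CF.
have dFf := dif_continuous tD (dnear_point tD df) dF.
apply: (@Ck_step _ _ k _ _ _
  (fun v s => \sum_i fcoord fr i (der v f s) *: 'D_(fvec fr i) F (f s))).
- apply: filterS2 (filterI df (dnear_dom t)) dFf => s [dfs sD] dFs.
  exact: dif_comp.
- move=> v; apply: filterS2 (filterI df (dnear_dom t)) dFf => s [dfs sD] dFs.
  by rewrite (der_comp v sD dfs dFs) (diff_frame fr _ dFs).
- move=> v; apply: Ck_sum => i; apply: Ck_scale.
    by apply: Ck_lin; [exact: fcoord_continuous|exact: Df].
  by apply: (IH _ ('D_(fvec fr i) F)); [exact: CkW|exact: (DF (fvec fr i))].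
Qed.

Lemma smooth_near_comp (C : dcalc R) (E : normedModType R) (fr : frame E)
    (W : normedModType R) (f : C -> E) (F : E -> W) (t : C) : ddom t ->
  smooth_near f t -> smooth_near (C := euclid E) F (f t) ->
  smooth_near (fun s => F (f s)) t.
Proof. by move=> tD sf sF k; exact: (Ck_comp fr). Qed.

Section Closure.
Context {C : dcalc R}.
Implicit Types (W : normedModType R) (t : C).

Lemma smooth_near_dif W (f : C -> W) t : ddom t -> smooth_near f t -> dif f t.
Proof. by move=> tD sf; exact: Ck_dif (sf 0). Qed.

Lemma smooth_near_eq W (f g : C -> W) t : dnear t (fun s => f s = g s) ->
  smooth_near f t -> smooth_near g t.
Proof. by move=> fg sf k; exact: Ck_eq (sf k). Qed.

Lemma smooth_near_cst W (w : W) t : smooth_near (fun=> w) t.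
Proof. by move=> k; exact: Ck_cst. Qed.

Lemma smooth_near_add W (f g : C -> W) t : smooth_near f t ->
  smooth_near g t -> smooth_near (fun s => f s + g s) t.
Proof. by move=> sf sg k; exact: Ck_add. Qed.

Lemma smooth_near_scale W (a : C -> R) (f : C -> W) t : smooth_near a t ->
  smooth_near f t -> smooth_near (fun s => a s *: f s) t.
Proof. by move=> sf sg k; exact: Ck_scale. Qed.

Lemma smooth_near_sum W m (f : 'I_m -> C -> W) t :
  (forall i, smooth_near (f i) t) -> smooth_near (fun s => \sum_i f i s) t.
Proof. by move=> sf k; apply: Ck_sum => i; exact: sf. Qed.

Lemma smooth_near_lin W W' (L : {linear W -> W'}) (f : C -> W) t :
  continuous L -> smooth_near f t -> smooth_near (fun s => L (f s)) t.
Proof. by move=> Lc sf k; exact: Ck_lin. Qed.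

Lemma smooth_near_pair W W' (f : C -> W) (g : C -> W') t : smooth_near f t ->
  smooth_near g t -> smooth_near (fun s => (f s, g s)) t.
Proof. by move=> sf sg k; exact: Ck_pair. Qed.

Lemma smooth_near_coord n (f : C -> 'rV[R]_n) i t :
  smooth_near f t -> smooth_near (fun s => rv_coord i (f s)) t.
Proof. by apply: smooth_near_lin; exact: coord_is_continuous. Qed.

End Closure.

Lemma smooth_onP (E W : normedModType R) (U : set E) (f : E -> W) : open U ->
  smooth_on U f <-> forall x, U x -> smooth_near (C := euclid E) f x.
Proof.
move=> oU; split.
  move=> sf x Ux k; elim: k f sf => [|k IH] f sf; split=> //.
  - by apply: filterS (open_nbhs_nbhs (conj oU Ux)) => y; exact: (sf [::]).
  - by apply: filterS (open_nbhs_nbhs (conj oU Ux)) => y; exact: (sf [::]).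
  (* In [iterD] the last direction of the list is the first to be applied, and [Ck] begins with that
     one; hence [rcons]. *)
  - move=> v; apply: IH => s y Uy; have := sf (rcons s v) y Uy.
    by rewrite /Defs.iterD foldr_rcons.
move=> sf s x Ux; move: (sf x Ux (size s)) => {sf}.
elim/last_ind: s f => [|s v IH] f; first by case=> /nbhs_singleton.
by rewrite size_rcons => -[_ /(_ v)/IH]; rewrite /Defs.iterD foldr_rcons.
Qed.

Section SmoothWithin.
Context (A : set R).
Hypothesis perfectA : forall t, A t -> ProperFilter (within A t^').

(** B is open relative to A, so the difference quotients relative to B and to A have the same limits
    at points of B. The intended B is the set of times at which a curve lies in a chart domain, and
    A the whole interval. *)
Lemma smooth_withinP (W : normedModType R) (B : set R) (f : R -> W) :
  B `<=` A -> (forall t, B t -> within A (nbhs t) B) ->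
  smooth_within B f <->
  forall t, B t -> smooth_near (C := curve_calc perfectA) f t.
Proof.
move=> BA AB.
have eqBA t (h : R -> W) : B t -> dquot B h t = dquot A h t.
  move=> Bt; rewrite eqEsubset; split => P; rewrite /dquot/= => H.
    have {}H : nbhs t (fun s => s != t -> B s -> P ((s - t)^-1 *: (h s - h t))).
      exact: H.
    have BN : nbhs t (fun s => A s -> B s) := AB t Bt.
    have : nbhs t (fun s => s != t -> A s -> P ((s - t)^-1 *: (h s - h t))).
      apply: filterS2 BN H => s ABs Hs st As.
      by apply: Hs => //; exact: ABs.
    exact.
  have {}H : nbhs t (fun s => s != t -> A s -> P ((s - t)^-1 *: (h s - h t))).
    exact: H.
  have : nbhs t (fun s => s != t -> B s -> P ((s - t)^-1 *: (h s - h t))).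
    by apply: filterS H => s Hs st Bs; apply: Hs => //; exact: BA.
  exact.
have dE (h : R -> W) t : B t -> deriv_within B h t = deriv_within A h t.
  by move=> Bt; rewrite /deriv_within eqBA.
have dB (h : R -> W) t : B t -> derivable_within B h t = derivable_within A h t.
  by move=> Bt; rewrite /derivable_within eqBA.
have near_dE (h : R -> W) t : B t ->
    within A (nbhs t) (fun s => deriv_within B h s = deriv_within A h s).
  by move=> Bt; apply: filterS (AB t Bt) => s Bs; exact: dE.
split.
  move=> sf t Bt k; elim: k f sf => [|k IH] f sf; split=> //.
  - by apply: filterS (AB t Bt) => s Bs; rewrite /= -dB//; exact: (sf 0%N).
  - by apply: filterS (AB t Bt) => s Bs; rewrite /= -dB//; exact: (sf 0%N).
  - move=> v; apply: (@Ck_eq _ (curve_calc perfectA) k W (deriv_within B f)).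
      exact: near_dE.
    apply: IH => j s Bs.
    by have := sf j.+1 s Bs; rewrite /derivn_within iterSr.
move=> sf k; elim: k f sf => [|k IH] f sf t Bt.
  by rewrite dB//; have [/nbhs_singleton H _] := sf t Bt 0; exact: H (BA _ Bt).
rewrite /derivn_within iterSr; apply: IH => // s Bs.
apply: (@smooth_near_eq (curve_calc perfectA) W (deriv_within A f)).
  by apply: filterS (near_dE f s Bs) => r ->.
exact: (smooth_near_der (tt : ddir (curve_calc perfectA)) (sf s Bs)).
Qed.

End SmoothWithin.

Lemma perfect_itv (a b : R) : a < b ->
  forall t, `[a, b]%classic t -> ProperFilter (within `[a, b]%classic t^').
Proof.
move=> ab t; rewrite /= in_itv/= => /andP[at_ tb].
apply: Build_ProperFilter_ex => P HP.
have HN : nbhs t (fun s => s != t -> `[a, b]%classic s -> P s) := HP.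
move: HN => /nbhs_ballP[r /= r0 rP].
(* A point of the interval other than t is sought within distance r: to the right of t when there is
   room, to the left when t = b. *)
have [t_b|b_t] := ltP t b.
  pose d := Num.min (r / 2) (b - t).
  have d0 : 0 < d by rewrite lt_min divr_gt0//= subr_gt0.
  have dr : d < r by rewrite gt_min; apply/orP; left; lra.
  have db : d <= b - t by rewrite ge_min lexx orbT.
  exists (t + d); apply: rP.
  - by rewrite /ball/= opprD addrA subrr add0r normrN gtr0_norm.
  - by rewrite -subr_eq0 addrAC subrr add0r gt_eqF.
  - by rewrite /= in_itv/=; apply/andP; split; lra.
pose d := Num.min (r / 2) (t - a).
have d0 : 0 < d by rewrite lt_min divr_gt0//= subr_gt0; lra.
have dr : d < r by rewrite gt_min; apply/orP; left; lra.
have db : d <= t - a by rewrite ge_min lexx orbT.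
exists (t - d); apply: rP.
- by rewrite /ball/= opprD addrA subrr add0r opprK gtr0_norm.
- by rewrite -subr_eq0 addrAC subrr add0r oppr_eq0 gt_eqF.
- by rewrite /= in_itv/=; apply/andP; split; lra.
Qed.

End Comp.

Notation smx := (@smooth_near _ (euclid _) _).

(** * Functions, fields and maps on manifolds *)

Section Local.
Context {R : realType} {E W : normedModType R}.
Implicit Types (f g : E -> W) (x u : E).

(** Passing to the interior of U spares a proof that the domains on which coordinate expressions of
    maps are considered are open. *)
Lemma smooth_on_near (U : set E) f x : smooth_on U f -> nbhs x U -> smx f x.
Proof.
move=> sf nU; have Ux : U° x := nU; have oU : open (U°) by exact: open_interior.
suff sU : smooth_on U° f by exact: ((smooth_onP f oU).1 sU x Ux).
by move=> s y /interior_subset; exact: sf.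
Qed.

Lemma smx_differentiable f x : smx f x -> differentiable f x.
Proof. by move=> sf; have [/nbhs_singleton] := sf 0%N. Qed.

Lemma diff_near_eq f g x u : (\forall y \near x, f y = g y) ->
  differentiable f x -> 'd f x u = 'd g x u.
Proof.
move=> fg df; have dg := near_eq_differentiable fg df.
by rewrite -(deriveE u df) -(deriveE u dg); exact: near_eq_derive.
Qed.

Lemma differentiable_idfun x : differentiable (fun y : E => y) x.
Proof. by have [] := is_diff_id x. Qed.

Lemma diff_idfun x u : 'd (fun y : E => y) x u = u.
Proof. by have [_ ->] := is_diff_id x. Qed.

End Local.

Section SmxLinear.
Context {R : realType}.

Lemma smx_id (E : normedModType R) (x : E) : smx (fun y : E => y) x.
Proof.
move=> k; case: k => [|k]; (split; first by apply: filterE => y;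
  exact: differentiable_idfun) => //= v.
apply: (@Ck_eq _ (euclid E) _ _ (fun=> v)); last exact: Ck_cst.
by apply: filterE => y; rewrite derive_id.
Qed.

Lemma smx_fst (E E' : normedModType R) (z : E * E') :
  smx (fun z : E * E' => z.1) z.
Proof.
pose L : {linear (E * E')%type -> E} := fst.
apply: (@smooth_near_lin _ (euclid _) _ _ L (fun z => z)); last exact: smx_id.
by move=> w; exact: cvg_fst.
Qed.

Lemma smx_snd (E E' : normedModType R) (z : E * E') :
  smx (fun z : E * E' => z.2) z.
Proof.
pose L : {linear (E * E')%type -> E'} := snd.
apply: (@smooth_near_lin _ (euclid _) _ _ L (fun z => z)); last exact: smx_id.
by move=> w; exact: cvg_snd.
Qed.

End SmxLinear.

Section Manifold.
Context {R : realType} {n : nat}.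
Local Notation E := 'rV[R]_n.

Section OneManifold.
Context {M : manifoldType R n}.
Implicit Types (c d : chart R n M) (p q : M) (W : normedModType R).

Lemma mem_cimg c p : cdom c p -> cimg c (c p).
Proof. by move=> cp; exists p. Qed.

Lemma cinv_dom c x : cimg c x -> cdom c (cinv c x).
Proof. by move=> [q cq <-]; rewrite cmapK. Qed.

Lemma cinvK c x : cimg c x -> c (cinv c x) = x.
Proof. by move=> [q cq <-]; rewrite cmapK. Qed.

Lemma near_cimg c p : cdom c p -> \forall x \near c p, cimg c x.
Proof.
by move=> cp; apply: open_nbhs_nbhs; split; [exact: cimg_open|exact: mem_cimg].
Qed.

Lemma near_cdom c p : cdom c p -> \forall q \near p, cdom c q.
Proof. by move=> cp; apply: open_nbhs_nbhs; split=> //; exact: cdom_open. Qed.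

Lemma chart_cvg c p : cdom c p -> c @ p --> c p.
Proof.
move=> cp; have := @cmap_continuous _ _ _ c.
rewrite continuous_open_subspace; last exact: cdom_open.
by apply; rewrite inE.
Qed.

Lemma cinv_cvg c p : cdom c p -> cinv c @ c p --> p.
Proof.
move=> cp; have := @cinv_continuous _ _ _ c.
rewrite continuous_open_subspace; last exact: cimg_open.
move=> /(_ (c p)); rewrite inE => /(_ (mem_cimg cp)) H.
by rewrite -[X in _ --> X](cmapK cp).
Qed.

Lemma near_cinv c p (P : set M) : cdom c p -> (\forall q \near p, P q) ->
  \forall x \near c p, P (cinv c x).
Proof. by move=> cp /(cinv_cvg cp). Qed.

Lemma near_chart c p (P : set E) : cdom c p -> (\forall x \near c p, P x) ->
  \forall q \near p, P (c q).
Proof. by move=> cp /(chart_cvg cp). Qed.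

Lemma smx_transition c d p : atlas c -> atlas d -> cdom c p -> cdom d p ->
  smx (d \o cinv c) (c p).
Proof.
move=> ac ad cp dp; refine (smooth_on_near (atlas_compat _ _ ac ad) _).
apply: filterS2 (near_cimg cp) (near_cinv cp (near_cdom dp)) => x cx dx.
by exists (cinv c x); [split=> //; exact: cinv_dom|exact: cinvK].
Qed.

Lemma near_transition W (f : M -> W) c d p : cdom c p -> cdom d p ->
  \forall x \near c p, (f \o cinv c) x = (f \o cinv d) ((d \o cinv c) x).
Proof.
move=> cp dp; apply: filterS (near_cinv cp (near_cdom dp)) => x dx /=.
by rewrite cmapK.
Qed.

Lemma smx_chart W (f : M -> W) c d p : atlas c -> atlas d ->
  cdom c p -> cdom d p -> smx (f \o cinv d) (d p) -> smx (f \o cinv c) (c p).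
Proof.
move=> ac ad cp dp sf.
apply: (@smooth_near_eq _ (euclid E) _ (fun x =>
  (f \o cinv d) ((d \o cinv c) x))).
  by apply: filterS (near_transition f cp dp) => x ->.
apply: (smooth_near_comp rv_frame) => //; first exact: smx_transition.
by rewrite /= cmapK.
Qed.

(** Smoothness at one point, so that it also applies to functions that are meaningful only locally,
    such as charts. Testing in the single chart [chart_at p] suffices, by the compatibility of the
    atlas ([msmP]). *)
Definition msm W (f : M -> W) p := smx (f \o cinv (chart_at p)) (chart_at p p).

Lemma msmP W (f : M -> W) c p : atlas c -> cdom c p ->
  msm f p <-> smx (f \o cinv c) (c p).
Proof.
move=> ac cp; have aq := @atlas_chart_at _ _ M p; have cq :=
  @mem_chart_at _ _ M p.
by split; exact: smx_chart.
Qed.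

Lemma smooth_funP W (f : M -> W) : smooth_fun f <-> forall p, msm f p.
Proof.
split=> [sf p|sf c ac].
  refine (smooth_on_near (sf _ (@atlas_chart_at _ _ M p)) _).
  by apply: near_cimg; exact: mem_chart_at.
apply/smooth_onP; first exact: cimg_open.
by move=> x [p cp <-]; apply/msmP.
Qed.

(** The components of X are taken in a fixed chart c. The raw function X may be discontinuous,
    because [chart_at q] may jump with q. *)
Lemma smooth_fieldP (X : M -> E) : smooth_field X <->
  forall c p, atlas c -> cdom c p -> msm (fun q => dfun c q (X q)) p.
Proof.
split=> [sX c p ac cp|sX c ac].
  by apply/(msmP _ ac cp); refine (smooth_on_near (sX c ac) _);
    exact: near_cimg.
apply/smooth_onP; first exact: cimg_open.
by move=> x [p cp <-]; have /(msmP _ ac cp) := sX c p ac cp.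
Qed.

Lemma msm_eq W (f g : M -> W) p : (\forall q \near p, f q = g q) ->
  msm f p -> msm g p.
Proof.
move=> fg; apply: smooth_near_eq.
exact: near_cinv (@mem_chart_at _ _ M p) fg.
Qed.

Lemma msm_cst W (w : W) p : msm (fun=> w) p.
Proof. exact: (@smooth_near_cst _ (euclid E)). Qed.

Lemma msm_add W (f g : M -> W) p :
  msm f p -> msm g p -> msm (fun q => f q + g q) p.
Proof. exact: (@smooth_near_add _ (euclid E)). Qed.

Lemma msm_scale W (a : M -> R) (f : M -> W) p :
  msm a p -> msm f p -> msm (fun q => a q *: f q) p.
Proof. exact: (@smooth_near_scale _ (euclid E)). Qed.

Lemma msm_sum W m (f : 'I_m -> M -> W) p :
  (forall i, msm (f i) p) -> msm (fun q => \sum_i f i q) p.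
Proof. exact: (@smooth_near_sum _ (euclid E)). Qed.

Lemma msm_coord m (f : M -> 'rV[R]_m) i p :
  msm f p -> msm (fun q => rv_coord i (f q)) p.
Proof. exact: (@smooth_near_coord _ (euclid E)). Qed.

Lemma msm_chart W c (F : E -> W) p : atlas c -> cdom c p -> smx F (c p) ->
  msm (fun q => F (c q)) p.
Proof.
move=> ac cp sF; apply/(msmP _ ac cp).
apply: smooth_near_eq sF.
by apply: filterS (near_cimg cp) => x cx /=; rewrite cinvK.
Qed.

Lemma msm_comp W W' (fr : frame W) (f : M -> W) (F : W -> W') p :
  msm f p -> smx F (f p) -> msm (fun q => F (f q)) p.
Proof.
move=> sf sF; apply: (smooth_near_comp fr) => //.
by rewrite /= cmapK//; exact: mem_chart_at.
Qed.

Lemma dfunE W (f : M -> W) p u : msm f p ->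
  dfun f p u = der (d := euclid E) u (f \o cinv (chart_at p)) (chart_at p p).
Proof. by move=> /smx_differentiable df; rewrite /= deriveE. Qed.

Lemma dfun_eq W (f g : M -> W) p u : (\forall q \near p, f q = g q) ->
  msm f p -> dfun f p u = dfun g p u.
Proof.
move=> fg /smx_differentiable df; apply: diff_near_eq df.
exact: near_cinv (@mem_chart_at _ _ M p) fg.
Qed.

Lemma dfun_cst W (w : W) p u : dfun (fun=> w) p u = 0.
Proof. by rewrite (dfunE _ (msm_cst w p)) der_cst. Qed.

Lemma dfun_add W (f g : M -> W) p u : msm f p -> msm g p ->
  dfun (fun q => f q + g q) p u = dfun f p u + dfun g p u.
Proof.
move=> sf sg; rewrite !dfunE//; last exact: msm_add.
by rewrite -derD//; exact: smooth_near_dif.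
Qed.

Lemma dfun_scale W (a : M -> R) (f : M -> W) p u : msm a p -> msm f p ->
  dfun (fun q => a q *: f q) p u = a p *: dfun f p u + dfun a p u *: f p.
Proof.
move=> sa sf; rewrite !dfunE//; last exact: msm_scale.
rewrite (@der_scale _ (euclid E))//; try exact: (@smooth_near_dif _ (euclid E)).
by rewrite /= cmapK//; exact: mem_chart_at.
Qed.

Lemma dfun_sum W m (f : 'I_m -> M -> W) p u : (forall i, msm (f i) p) ->
  dfun (fun q => \sum_i f i q) p u = \sum_i dfun (f i) p u.
Proof.
move=> sf; rewrite dfunE; last exact: msm_sum.
rewrite (@der_sum _ (euclid E))//; last first.
  by move=> i; exact: (@smooth_near_dif _ (euclid E) _ _ _ I (sf i)).
by apply: eq_bigr => i _; rewrite dfunE.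
Qed.

Lemma dfun_coord m (f : M -> 'rV[R]_m) i p u : msm f p ->
  dfun (fun q => rv_coord i (f q)) p u = rv_coord i (dfun f p u).
Proof.
move=> sf; rewrite !dfunE//; last exact: msm_coord.
rewrite -(@der_lin _ (euclid E) _ _ (rv_coord i))//;
  first exact: coord_is_continuous.
exact: (@smooth_near_dif _ (euclid E)).
Qed.

(** This is the chain rule: [dfun c p u] is the differential of the transition map from [chart_at p]
    to c, applied to u. *)
Lemma dfun_chart W (f : M -> W) c p u : atlas c -> cdom c p ->
  differentiable (f \o cinv c) (c p) ->
  dfun f p u = 'd (f \o cinv c) (c p) (dfun c p u).
Proof.
move=> ac cp df; have aq := @atlas_chart_at _ _ M p.
have cq := @mem_chart_at _ _ M p.
have st := smx_transition aq ac cq cp.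
have dt : differentiable (c \o cinv (chart_at p)) (chart_at p p).
  exact: smx_differentiable st.
have E1 : (c \o cinv (chart_at p)) (chart_at p p) = c p by rewrite /= cmapK.
have dft : differentiable (f \o cinv c)
  ((c \o cinv (chart_at p)) (chart_at p p)) by rewrite E1.
have dc : differentiable ((f \o cinv c) \o (c \o cinv (chart_at p)))
  (chart_at p p) by exact: differentiable_comp.
have fE : \forall x \near chart_at p p,
    ((f \o cinv c) \o (c \o cinv (chart_at p))) x = (f \o cinv (chart_at p)) x.
  by apply: filterS (near_transition f cq cp) => x ->.
have E2 : 'd (f \o cinv (chart_at p)) (chart_at p p) u =
    'd (f \o cinv c) ((c \o cinv (chart_at p)) (chart_at p p)) (dfun c p u).
  apply: (etrans (esym (diff_near_eq u fE dc))).
  exact: (congr1 (@^~ u) (diff_comp dt dft)).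
apply: (etrans E2).
exact: (congr1 (fun y => 'd (f \o cinv c) y (dfun c p u)) E1).
Qed.

Lemma dfun_chart_at p u : dfun (chart_at p) p u = u.
Proof.
have cp := @mem_chart_at _ _ M p.
have E1 : \forall x \near chart_at p p,
    x = (chart_at p \o cinv (chart_at p)) x.
  by apply: filterS (near_cimg cp) => x cx /=; rewrite cinvK.
apply: (etrans (esym (diff_near_eq u E1 (differentiable_idfun _)))).
exact: diff_idfun.
Qed.

Lemma dfun_is_linear W (f : M -> W) p : linear (dfun f p).
Proof. by move=> a u v; exact: linearP. Qed.

End OneManifold.
End Manifold.

Lemma derive_comm_rv (R : realType) (E : normedModType R) m
    (f : E -> 'rV[R]_m) x v w : smx f x -> 'D_w ('D_v f) x = 'D_v ('D_w f) x.
Proof.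
move=> sf; apply: rv_eq => i.
have sDf u : smx ('D_u f) x by exact: (smooth_near_der (C := euclid E) u sf).
have dcoord u (g : E -> 'rV[R]_m) y : differentiable g y ->
    'D_u (fun z => rv_coord i (g z)) y = rv_coord i ('D_u g y).
  move=> dg; apply: (@der_lin _ (euclid E) _ _ (rv_coord i) g u y) => //.
  exact: coord_is_continuous.
have ndf : \forall y \near x, differentiable f y by case: (sf 0%N).
have sfi : smx (fun z => rv_coord i (f z)) x.
  exact: (@smooth_near_coord _ (euclid E)).
have Dnear u : \forall y \near x,
    'D_u (fun z => rv_coord i (f z)) y = rv_coord i ('D_u f y).
  by apply: filterS ndf => y; exact: dcoord.
have dv := smx_differentiable (sDf v); have dw := smx_differentiable (sDf w).
apply: (etrans (esym (dcoord w _ _ dv))).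
apply: (etrans _ (dcoord v _ _ dw)).
apply: (etrans (esym (near_eq_derive w (Dnear v)))).
apply: (etrans _ (near_eq_derive v (Dnear w))).
apply: derive_comm; first by case: (sfi 0%N).
- exact/smx_differentiable/(smooth_near_der (C := euclid E) v sfi).
- exact/smx_differentiable/(smooth_near_der (C := euclid E) w sfi).
Qed.

(** * Lie derivatives and the bracket *)

Section LieDerivative.
Context {R : realType} {n : nat} {M : manifoldType R n}.
Local Notation E := 'rV[R]_n.
Implicit Types (c d : chart R n M) (p q : M) (W : normedModType R).

(** Each [dfun f q] is computed in the chart preferred at q; this one formula in the chart c, valid
    for all q near p, exhibits the smooth dependence on q. *)
Lemma near_dfun W (f : M -> W) c p : atlas c -> cdom c p -> msm f p ->
  \forall q \near p, forall u, dfun f q u =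
    \sum_i rv_coord i (dfun c q u) *: 'D_(rv_vec i) (f \o cinv c) (c q).
Proof.
move=> ac cp /(msmP _ ac cp) sf.
have df : \forall x \near c p, differentiable (f \o cinv c) x by case: (sf 0%N).
apply: filterS2 (near_chart cp df) (near_cdom cp) => q dq cq u.
by rewrite (dfun_chart u ac cq dq) (diff_frame rv_frame).
Qed.

Lemma msm_derive W (f : M -> W) c p v : atlas c -> cdom c p -> msm f p ->
  msm (fun q => 'D_v (f \o cinv c) (c q)) p.
Proof.
move=> ac cp /(msmP _ ac cp) sf.
apply: (@msm_chart _ _ _ _ c ('D_v (f \o cinv c)) p ac cp).
exact: (smooth_near_der (C := euclid E) v sf).
Qed.

Lemma msm_lie W (f : M -> W) X p : smooth_field X -> msm f p ->
  msm (fun q => dfun f q (X q)) p.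
Proof.
move=> /smooth_fieldP sX sf.
have ac := @atlas_chart_at _ _ M p; have cp := @mem_chart_at _ _ M p.
apply: (@msm_eq _ _ _ _ (fun q => \sum_i
    rv_coord i (dfun (chart_at p) q (X q)) *:
    'D_(rv_vec i) (f \o cinv (chart_at p)) (chart_at p q))).
  by apply: filterS (near_dfun ac cp sf) => q ->.
apply: msm_sum => i; apply: msm_scale; last exact: msm_derive.
by apply: msm_coord; exact: sX.
Qed.

(* The expansion [X^j d_j (Y^i d_i f)] in the chart at p, whose second order
   part is symmetric in X and Y. *)
Let dfun_lie m (f : M -> 'rV[R]_m) Y p u : smooth_field Y -> msm f p ->
  let c := chart_at p in
  dfun (fun q => dfun f q (Y q)) p u =
    'D_(Y p) ('D_u (f \o cinv c)) (c p) + dfun f p ('d (field_in c Y) (c p) u).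
Proof.
move=> /smooth_fieldP sY sf c; set F := f \o cinv c.
have ac : atlas c by exact: atlas_chart_at.
have cp : cdom c p by exact: mem_chart_at.
have sF : smx F (c p) := sf.
have sYc : msm (fun q => dfun c q (Y q)) p by exact: sY.
have sDF v : smx ('D_v F) (c p) := smooth_near_der (C := euclid E) v sF.
pose a i q := rv_coord i (dfun c q (Y q)).
pose b (i : 'I_n) q := 'D_(rv_vec i) F (c q).
have sa i : msm (a i) p by exact: msm_coord.
have sb i : msm (b i) p by exact: msm_derive.
have sab i : msm (fun q => a i q *: b i q) p by exact: msm_scale.
rewrite -(@dfun_eq _ _ _ _ (fun q => \sum_i a i q *: b i q)); last 2 first.
- by apply: filterS (near_dfun ac cp sf) => q ->.
- exact: msm_sum.
rewrite dfun_sum//; under eq_bigr do rewrite dfun_scale//.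
rewrite big_split/=; congr (_ + _).
  have dDF : differentiable ('D_u F) (c p) := smx_differentiable (sDF u).
  rewrite (deriveE _ dDF) (diff_frame rv_frame)//; apply: eq_bigr => i _.
  rewrite /a dfun_chart_at/=; congr (_ *: _).
  rewrite -derive_comm_rv// deriveE; last exact: smx_differentiable.
  rewrite /dfun; apply: esym; apply: diff_near_eq;
    last exact: smx_differentiable.
  by apply: filterS (near_cimg cp) => x cx; rewrite /b /= cinvK.
rewrite [RHS](diff_frame rv_frame); last exact: smx_differentiable.
by apply: eq_bigr => i _; rewrite /a dfun_coord.
Qed.

(** The second derivatives of f in X (Y f) and Y (X f) cancel by symmetry, and the first order terms
    form the coordinate expression of the bracket. Unlike that expression, the commutator can be
    transported along maps. *)
Lemma lie_bracketE m (f : M -> 'rV[R]_m) X Y p :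
  smooth_field X -> smooth_field Y -> msm f p ->
  dfun f p (bracket X Y p) =
  dfun (fun q => dfun f q (Y q)) p (X p) - dfun (fun q =>
    dfun f q (X q)) p (Y p).
Proof.
move=> sX sY sf; rewrite !dfun_lie// /bracket [LHS]linearB/=.
have aux (a b c d : 'rV[R]_m) : a = b -> c - d = a + c - (b + d).
  by move=> ->; rewrite opprD addrACA subrr add0r.
exact: aux (derive_comm_rv (X p) (Y p) sf).
Qed.

End LieDerivative.

Section Maps.
Context {R : realType} {n : nat}.
Local Notation E := 'rV[R]_n.
Implicit Types (M N P : manifoldType R n) (W : normedModType R).

(** Continuity is a separate requirement: the chart at F p describes F near p only if F sends nearby
    points into its domain. *)
Definition msmap M N (F : M -> N) p :=
  F @ p --> F p /\ msm (chart_at (F p) \o F) p.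

Lemma near_msmap M N W (F : M -> N) (f : N -> W) p : F @ p --> F p ->
  \forall q \near p,
    (f \o F) q = (f \o cinv (chart_at (F p))) ((chart_at (F p) \o F) q).
Proof.
move=> cF.
have H : \forall q \near p, cdom (chart_at (F p)) (F q).
  exact: cF (near_cdom (@mem_chart_at _ _ N (F p))).
by apply: filterS H => q dq /=; rewrite cmapK.
Qed.

Lemma msm_msmap M N W (F : M -> N) (f : N -> W) p : msmap F p ->
  msm f (F p) -> msm (f \o F) p.
Proof.
move=> [cF sF] sf; apply: (@msm_eq _ _ _ _ (fun q =>
    (f \o cinv (chart_at (F p))) ((chart_at (F p) \o F) q))).
  by apply: filterS (near_msmap f cF) => q ->.
exact: (@msm_comp _ _ _ _ _ rv_frame (chart_at (F p) \o F)
  (f \o cinv (chart_at (F p))) p sF sf).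
Qed.

Lemma dfun_msmap M N W (F : M -> N) (f : N -> W) p u : msmap F p ->
  msm f (F p) -> dfun (f \o F) p u = dfun f (F p) (tmap F p u).
Proof.
move=> mF sf; have [cF sF] := mF; have sfF := msm_msmap mF sf.
apply: (etrans (dfun_eq u (near_msmap f cF) sfF)).
pose y := chart_at (F p) \o F \o cinv (chart_at p).
have dy : differentiable y (chart_at p p) := smx_differentiable sF.
have yE : y (chart_at p p) = chart_at (F p) (F p).
  by rewrite /y /= cmapK//; exact: mem_chart_at.
have df : differentiable (f \o cinv (chart_at (F p))) (y (chart_at p p)).
  by rewrite yE; exact: smx_differentiable.
apply: (etrans (congr1 (@^~ u) (diff_comp dy df))).
exact: (congr1 (fun z => 'd (f \o cinv (chart_at (F p))) z (tmap F p u)) yE).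
Qed.

Lemma tmap_comp M N P (F : M -> N) (H : N -> P) p u : msmap F p ->
  msmap H (F p) -> tmap (H \o F) p u = tmap H (F p) (tmap F p u).
Proof. by move=> mF [_ sH]; rewrite /tmap -dfun_msmap. Qed.

Lemma tmap_id M (p : M) u : tmap (fun q => q) p u = u.
Proof. exact: dfun_chart_at. Qed.

Lemma tmap_is_linear M N (F : M -> N) p : linear (tmap F p).
Proof. exact: dfun_is_linear. Qed.

Lemma msm_chart_fun M (c : chart R n M) p : atlas c -> cdom c p -> msm c p.
Proof.
move=> ac cp; apply: (@msm_chart _ _ _ _ _ (fun x => x)) => //.
exact: smx_id.
Qed.

Lemma smooth_map_msmap M N (F : M -> N) p : smooth_map F -> msmap F p.
Proof.
move=> [cF sF]; split; first exact: cF.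
have cp := @mem_chart_at _ _ M p; have dp := @mem_chart_at _ _ N (F p).
have sc := sF _ _ (@atlas_chart_at _ _ M p) (@atlas_chart_at _ _ N (F p)).
refine (smooth_on_near sc _); apply: filterI; first exact: near_cimg.
exact: near_cinv cp (cF _ _ (near_cdom dp)).
Qed.

End Maps.

(** * Left- and right-invariant fields *)

Section Partial.
Context {R : realType} {E E' W : normedModType R}.
Implicit Types (f : E * E' -> W).

Lemma partial2 f x y u : differentiable f (x, y) ->
  differentiable (fun z => f (x, z)) y /\
  'd (fun z => f (x, z)) y u = 'd f (x, y) (0, u).
Proof.
move=> df.
have dp : is_diff y (fun z : E' => (x, z)) (fun u => (0, u)).
  have d1 := is_diff_cst x y; have d2 := is_diff_id y.
  exact: (is_diff_pair d1 d2).
have [dpx dpE] := dp.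
have dfp : differentiable f ((fun z : E' => (x, z)) y) by [].
split; first exact: (differentiable_comp dpx dfp).
apply: (etrans (congr1 (@^~ u) (diff_comp dpx dfp))).
exact: (congr1 (fun h : E' -> E * E' => 'd f (x, y) (h u)) dpE).
Qed.

Lemma partial1 f x y u : differentiable f (x, y) ->
  differentiable (fun z => f (z, y)) x /\
  'd (fun z => f (z, y)) x u = 'd f (x, y) (u, 0).
Proof.
move=> df.
have dp : is_diff x (fun z : E => (z, y)) (fun u => (u, 0)).
  have d1 := is_diff_id x; have d2 := is_diff_cst y x.
  exact: (is_diff_pair d1 d2).
have [dpx dpE] := dp.
have dfp : differentiable f ((fun z : E => (z, y)) x) by [].
split; first exact: (differentiable_comp dpx dfp).
apply: (etrans (congr1 (@^~ u) (diff_comp dpx dfp))).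
exact: (congr1 (fun h : E -> E * E' => 'd f (x, y) (h u)) dpE).
Qed.

End Partial.

Section LieGroup.
Context {R : realType} {n : nat} {G : lieGroupType R n}.
Local Notation E := 'rV[R]_n.
Implicit Types (c d e : chart R n G) (g h p q : G) (u v w : E).

Lemma mul_smx c d e p q : atlas c -> atlas d -> atlas e ->
  cdom c p -> cdom d q -> cdom e (p * q)%g ->
  smx (fun z : E * E => e (cinv c z.1 * cinv d z.2)%g) (c p, d q).
Proof.
move=> ac ad ae cp dq epq; have [cm sm] := @mulg_smooth R n G.
refine (smooth_on_near (sm c d e ac ad ae) _).
have c1 : (fun z : E * E => cinv c z.1) @ (c p, d q) --> p.
  exact: cvg_comp (@cvg_fst _ _ _ _ _) (cinv_cvg cp).
have c2 : (fun z : E * E => cinv d z.2) @ (c p, d q) --> q.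
  exact: cvg_comp (@cvg_snd _ _ _ _ _) (cinv_cvg dq).
have c12 : (fun z : E * E => (cinv c z.1, cinv d z.2)) @ (c p, d q) --> (p, q).
  exact: cvg_pair c1 c2.
have c3 : (fun z : E * E => cinv c z.1 * cinv d z.2)%g @ (c p, d q) -->
  (p * q)%g.
  exact: cvg_comp c12 (cm (p, q)).
have n1 : \forall z \near (c p, d q), cimg c z.1.
  exact: (@cvg_fst _ _ (nbhs (c p)) (nbhs (d q)) _ _ (near_cimg cp)).
have n2 : \forall z \near (c p, d q), cimg d z.2.
  exact: (@cvg_snd _ _ (nbhs (c p)) (nbhs (d q)) _ _ (near_cimg dq)).
have n3 : \forall z \near (c p, d q), cdom e (cinv c z.1 * cinv d z.2)%g.
  exact: c3 (near_cdom epq).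
by apply: filterS3 n1 n2 n3 => z; split.
Qed.

Lemma Ltrans_cvg g p : Ltrans g @ p --> Ltrans g p.
Proof.
have [cm _] := @mulg_smooth R n G.
have c : (fun q => (g, q)) @ p --> (g, p).
  exact: cvg_pair (@cvg_cst _ g _ (nbhs p) _) cvg_id.
exact: cvg_comp c (cm (g, p)).
Qed.

Lemma Rtrans_cvg g p : Rtrans g @ p --> Rtrans g p.
Proof.
have [cm _] := @mulg_smooth R n G.
have c : (fun q => (q, g)) @ p --> (p, g).
  exact: cvg_pair cvg_id (@cvg_cst _ g _ (nbhs p) _).
exact: cvg_comp c (cm (p, g)).
Qed.

Lemma msmap_Ltrans g p : msmap (Ltrans g) p.
Proof.
split; first exact: Ltrans_cvg.
have ac := @atlas_chart_at _ _ G; have cp := @mem_chart_at _ _ G.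
have sm := mul_smx (ac g) (ac p) (ac (g * p)%g) (cp g) (cp p) (cp (g * p)%g).
rewrite /msm; set c := chart_at p.
apply: (@smooth_near_eq _ (euclid E) _ (fun x => chart_at (g * p)%g
  (cinv (chart_at g) (chart_at g g, x).1 * cinv c (chart_at g g, x).2)%g)).
  by apply: filterE => x /=; rewrite cmapK.
apply: (@smooth_near_comp _ (euclid E) _ rv2_frame _ (fun x => (chart_at g g,
  x))
  (fun z => chart_at (g * p)%g (cinv (chart_at g) z.1 * cinv c z.2)%g)) => //.
by apply: smooth_near_pair; [exact: smooth_near_cst|exact: smx_id].
Qed.

Lemma msmap_Rtrans g p : msmap (Rtrans g) p.
Proof.
split; first exact: Rtrans_cvg.
have ac := @atlas_chart_at _ _ G; have cp := @mem_chart_at _ _ G.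
have sm := mul_smx (ac p) (ac g) (ac (p * g)%g) (cp p) (cp g) (cp (p * g)%g).
rewrite /msm; set c := chart_at p.
apply: (@smooth_near_eq _ (euclid E) _ (fun x => chart_at (p * g)%g
  (cinv c (x, chart_at g g).1 * cinv (chart_at g) (x, chart_at g g).2)%g)).
  by apply: filterE => x /=; rewrite cmapK.
apply: (@smooth_near_comp _ (euclid E) _ rv2_frame _ (fun x => (x,
  chart_at g g))
  (fun z => chart_at (p * g)%g (cinv c z.1 * cinv (chart_at g) z.2)%g)) => //.
by apply: smooth_near_pair; [exact: smx_id|exact: smooth_near_cst].
Qed.

Lemma tmap_Ltrans g h p u :
  tmap (Ltrans g) (h * p)%g (tmap (Ltrans h) p u) = tmap (Ltrans (g * h)%g) p u.
Proof.
have -> : Ltrans (g * h)%g = Ltrans g \o Ltrans h.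
  by apply/funext => q; rewrite /Ltrans/= mulgA.
exact: (esym (tmap_comp u (msmap_Ltrans h p) (msmap_Ltrans g (h * p)%g))).
Qed.

Lemma tmap_Ltrans1 p u : tmap (Ltrans (1%g : G)) p u = u.
Proof.
rewrite (_ : Ltrans 1%g = fun q => q) ?tmap_id//.
by apply/funext => q; exact: mul1g.
Qed.

(** The left trivialisation of the tangent bundle, inverse to [left_field] at each g by
    [left_fieldK] and [ltrivK]. *)
Definition ltriv g v : E := tmap (Ltrans g^-1%g) g v.

Lemma left_fieldK g u : ltriv g (left_field u g) = u.
Proof.
have := tmap_Ltrans g^-1%g g 1%g u; rewrite mulg1 mulVg tmap_Ltrans1.
exact.
Qed.

Lemma ltrivK g v : left_field (ltriv g v) g = v.
Proof.
have := tmap_Ltrans g g^-1%g g v; rewrite mulVg mulgV tmap_Ltrans1.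
exact.
Qed.

Lemma tmap_left_field g h u :
  tmap (Ltrans g) h (left_field u h) = left_field u (g * h)%g.
Proof. by have := tmap_Ltrans g h 1%g u; rewrite mulg1. Qed.

Lemma left_field1 u : left_field u (1%g : G) = u.
Proof. exact: tmap_Ltrans1. Qed.

Lemma left_fieldP g a u v :
  left_field (a *: u + v) g = a *: left_field u g + left_field v g.
Proof. exact: tmap_is_linear. Qed.

Lemma left_fieldD g u v :
  left_field (u + v) g = left_field u g + left_field v g.
Proof. by have := left_fieldP g 1 u v; rewrite !scale1r. Qed.

Lemma left_field0 g : left_field (0 : E) g = 0.
Proof. by have := left_fieldP g (-1) 0 0; rewrite scaler0 addr0 scaleN1r addNr.
  Qed.

Lemma left_fieldZ g a u : left_field (a *: u) g = a *: left_field u g.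
Proof. by have := left_fieldP g a u 0; rewrite left_field0 !addr0. Qed.

Lemma left_field_frame g u :
  left_field u g = \sum_i rv_coord i u *: left_field (rv_vec i) g.
Proof.
rewrite {1}(rv_sum u); elim/big_ind2: _; first exact: left_field0.
  by move=> x y x' y' <- <-; rewrite left_fieldD.
by move=> i _; rewrite left_fieldZ.
Qed.

(** These fields are compared at 1 with the left-invariant ones; that comparison is how invariance
    under right translations enters, in [lie_skew]. *)
Definition right_field u : G -> E := fun g => tmap (Rtrans g) (1%g : G) u.

Lemma right_field1 u : right_field u 1%g = u.
Proof.
rewrite /right_field (_ : Rtrans (1%g : G) = fun q => q) ?tmap_id//.
by apply/funext => q; exact: mulg1.
Qed.

(** The components become a partial derivative of the group law read in charts, with the second
    point kept at 1. Smoothness in q can be read off from this form. *)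
Lemma dfun_left_field c q u : atlas c -> cdom c q ->
  dfun c q (left_field u q) =
  'D_(0, u) (fun z : E * E => c (cinv c z.1 * cinv (chart_at 1%g) z.2)%g)
    (c q, chart_at 1%g (1%g : G)).
Proof.
move=> ac cq; have a1 := @atlas_chart_at _ _ G 1%g.
have c1 := @mem_chart_at _ _ G 1%g.
have cq1 : cdom c (q * 1)%g by rewrite mulg1.
have /smx_differentiable dm := mul_smx ac a1 ac cq c1 cq1.
have := @dfun_msmap _ _ _ _ _ (Ltrans q) c 1%g u (msmap_Ltrans q 1%g)
  (msm_chart_fun ac cq1).
rewrite {2}/Ltrans mulg1 => <-.
have [_ E2] := partial2 u dm; apply: (etrans _ (esym (deriveE _ dm))).
apply: (etrans _ E2).
have FE : c \o Ltrans q \o cinv (chart_at (1%g : G)) =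
    fun y : E => c (cinv c (c q) * cinv (chart_at 1%g) y)%g.
  by apply/funext => x /=; rewrite cmapK.
exact: (congr1 (fun f : E -> E => 'd f (chart_at (1%g : G) 1%g) u) FE).
Qed.

Lemma dfun_right_field c q u : atlas c -> cdom c q ->
  dfun c q (right_field u q) =
  'D_(u, 0) (fun z : E * E => c (cinv (chart_at 1%g) z.1 * cinv c z.2)%g)
    (chart_at 1%g (1%g : G), c q).
Proof.
move=> ac cq; have a1 := @atlas_chart_at _ _ G 1%g.
have c1 := @mem_chart_at _ _ G 1%g.
have cq1 : cdom c (1 * q)%g by rewrite mul1g.
have /smx_differentiable dm := mul_smx a1 ac ac c1 cq cq1.
have := @dfun_msmap _ _ _ _ _ (Rtrans q) c 1%g u (msmap_Rtrans q 1%g)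
  (msm_chart_fun ac cq1).
rewrite {2}/Rtrans mul1g => <-.
have [_ E2] := partial1 u dm; apply: (etrans _ (esym (deriveE _ dm))).
apply: (etrans _ E2).
have FE : c \o Rtrans q \o cinv (chart_at (1%g : G)) =
    fun y : E => c (cinv (chart_at 1%g) y * cinv c (c q))%g.
  by apply/funext => x /=; rewrite cmapK.
exact: (congr1 (fun f : E -> E => 'd f (chart_at (1%g : G) 1%g) u) FE).
Qed.

Lemma smooth_left_field u : smooth_field (left_field u : G -> E).
Proof.
apply/smooth_fieldP => c p ac cp; have a1 := @atlas_chart_at _ _ G 1%g.
have c1 := @mem_chart_at _ _ G 1%g.
have cp1 : cdom c (p * 1)%g by rewrite mulg1.
have sm := mul_smx ac a1 ac cp c1 cp1.
have sDm := smooth_near_der (C := euclid (E * E)%type) (0, u) sm.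
set m := (fun z => _) in sm sDm.
apply: (@msm_eq _ _ _ _ (fun q => 'D_(0, u) m (c q, chart_at 1%g (1%g : G)))).
  by apply: filterS (near_cdom cp) => q cq; rewrite dfun_left_field.
apply: (@msm_chart _ _ _ _ c (fun x => 'D_(0, u) m (x,
  chart_at 1%g (1%g : G)))) => //.
apply: (@smooth_near_comp _ (euclid E) _ rv2_frame _
  (fun x => (x, chart_at 1%g (1%g : G))) ('D_(0, u) m)) => //.
by apply: smooth_near_pair; [exact: smx_id|exact: smooth_near_cst].
Qed.

Lemma smooth_right_field u : smooth_field (right_field u).
Proof.
apply/smooth_fieldP => c p ac cp; have a1 := @atlas_chart_at _ _ G 1%g.
have c1 := @mem_chart_at _ _ G 1%g.
have cp1 : cdom c (1 * p)%g by rewrite mul1g.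
have sm := mul_smx a1 ac ac c1 cp cp1.
have sDm := smooth_near_der (C := euclid (E * E)%type) (u, 0) sm.
set m := (fun z => _) in sm sDm.
apply: (@msm_eq _ _ _ _ (fun q => 'D_(u, 0) m (chart_at 1%g (1%g : G), c q))).
  by apply: filterS (near_cdom cp) => q cq; rewrite dfun_right_field.
apply: (@msm_chart _ _ _ _ c (fun x => 'D_(u, 0) m (chart_at 1%g (1%g : G),
  x))) => //.
apply: (@smooth_near_comp _ (euclid E) _ rv2_frame _
  (fun x => (chart_at 1%g (1%g : G), x)) ('D_(u, 0) m)) => //.
by apply: smooth_near_pair; [exact: smooth_near_cst|exact: smx_id].
Qed.

(* Left translations commute with right translations; in coordinates this is
   the symmetry of the mixed second derivatives of the product. *)
Lemma bracket_left_right u v :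
  bracket (left_field u) (right_field v) (1%g : G) = 0.
Proof.
rewrite /bracket left_field1 right_field1.
have ac := @atlas_chart_at _ _ G 1%g; have c1 := @mem_chart_at _ _ G 1%g.
set c := chart_at (1%g : G) in ac c1 *; set y := c 1%g.
have c11 : cdom c (1 * 1)%g by rewrite mulg1.
have sm := mul_smx ac ac ac c1 c1 c11; rewrite -/y in sm.
set m := (fun z => _) in sm.
have sDm (w : E * E) : smx ('D_w m) (y, y).
  exact: (smooth_near_der (C := euclid (E * E)%type) w sm).
have /smx_differentiable dL := sDm (0, u).
have /smx_differentiable dR := sDm (v, 0).
have [dR2 ER2] := partial2 u dR; have [dL1 EL1] := partial1 v dL.
have ER : 'd (field_in c (right_field v)) y u = 'D_(0, u) ('D_(v, 0) m) (y, y).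
  apply: (etrans _ (esym (deriveE _ dR))); apply: (etrans _ ER2).
  apply: esym; apply: diff_near_eq dR2.
  apply: filterS (near_cimg c1) => x cx.
  have E3 := dfun_right_field v ac (cinv_dom cx); rewrite (cinvK cx) in E3.
  exact: (esym E3).
have EL : 'd (field_in c (left_field u)) y v = 'D_(v, 0) ('D_(0, u) m) (y, y).
  apply: (etrans _ (esym (deriveE _ dL))); apply: (etrans _ EL1).
  apply: esym; apply: diff_near_eq dL1.
  apply: filterS (near_cimg c1) => x cx.
  have E3 := dfun_left_field u ac (cinv_dom cx); rewrite (cinvK cx) in E3.
  exact: (esym E3).
apply/eqP; rewrite subr_eq0; apply/eqP; apply: (etrans ER);
  apply: (etrans _ (esym EL)).
exact: derive_comm_rv sm.
Qed.

End LieGroup.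

(** * Linear and bilinear maps of row vectors *)

Section RvLinear.
Context {R : realType} {m : nat}.
Local Notation E := 'rV[R]_m.

Lemma linear_rv (W : lmodType R) (h : E -> W) x : linear h ->
  h x = \sum_i rv_coord i x *: h (rv_vec i).
Proof.
move=> lh; pose hM := GRing.isLinear.Build _ _ _ _ _ lh.
pose hL : {linear E -> W} := HB.pack h hM.
rewrite -[h]/(hL : E -> W) {1}(rv_sum x) linear_sum; apply: eq_bigr => i _.
by rewrite linearZ.
Qed.

Lemma smx_rv_linear (W : normedModType R) (h : E -> W) x :
  linear h -> smx h x.
Proof.
move=> lh; apply: (@smooth_near_eq _ (euclid E) _
    (fun x => \sum_i rv_coord i x *: h (rv_vec i))).
  by apply: filterE => y; rewrite -linear_rv.
apply: smooth_near_sum => i; apply: smooth_near_scale;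
  last exact: smooth_near_cst.
apply: (@smooth_near_lin _ (euclid E) _ _ (rv_coord i) (fun x => x)).
  exact: coord_is_continuous.
exact: smx_id.
Qed.

Lemma rv_linear_continuous (W : normedModType R) (h : E -> W) :
  linear h -> continuous h.
Proof.
move=> lh x; apply: differentiable_continuous.
exact: smx_differentiable (smx_rv_linear x lh).
Qed.

Section Bilinear.
Context {C : dcalc R} (b : E -> E -> E).
Hypothesis blin_l : forall v, linear (b ^~ v).
Hypothesis blin_r : forall u, linear (b u).

Let bE u v : b u v = \sum_i rv_coord i u *: b (rv_vec i) v.
Proof. exact: (linear_rv u (blin_l v)). Qed.

(** Expanding the first argument in coordinates leaves scalings and the finitely many linear maps b
    (e_i). *)
Lemma smooth_near_bilin (f g : C -> E) t : ddom t ->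
  smooth_near f t -> smooth_near g t -> smooth_near (fun s => b (f s) (g s)) t.
Proof.
move=> tD sf sg; under eq_fun do rewrite bE.
apply: smooth_near_sum => i; apply: smooth_near_scale.
  exact: smooth_near_coord.
apply: (smooth_near_comp rv_frame tD sg); exact: smx_rv_linear.
Qed.

Lemma der_bilin (f g : C -> E) v t : ddom t ->
  smooth_near f t -> smooth_near g t ->
  der v (fun s => b (f s) (g s)) t = b (der v f t) (g t) + b (f t) (der v g t).
Proof.
move=> tD sf sg; under eq_fun do rewrite bE.
have sfi i : smooth_near (fun s => rv_coord i (f s)) t by exact:
  smooth_near_coord.
have sbi i : smooth_near (fun s => b (rv_vec i) (g s)) t.
  by apply: (smooth_near_comp rv_frame tD sg); exact: smx_rv_linear.
have dfi i := smooth_near_dif tD (sfi i); have dbi i :=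
  smooth_near_dif tD (sbi i).
have df := smooth_near_dif tD sf; have dg := smooth_near_dif tD sg.
rewrite der_sum//; last by move=> i; exact: dif_scale.
under eq_bigr => i _ do rewrite der_scale//.
rewrite big_split/= addrC; congr (_ + _).
  rewrite [RHS]bE; apply: eq_bigr => i _; congr (_ *: _).
  by rewrite (@der_lin _ _ _ _ (rv_coord i))//; exact: coord_is_continuous.
rewrite [RHS]bE; apply: eq_bigr => i _; congr (_ *: _).
have db := is_diff_linear (g t) (blin_r (rv_vec i)) (rv_linear_continuous
  (blin_r (rv_vec i))).
have [db1 db2] := db.
apply: (etrans (der_comp v tD dg db1)).
exact: (congr1 (@^~ (der v g t)) db2).
Qed.

End Bilinear.
End RvLinear.

Section Fields.
Context {R : realType} {n : nat} {M : manifoldType R n}.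
Local Notation E := 'rV[R]_n.
Implicit Types (X Y Z : M -> E) (p : M).

Lemma dfunP (W : normedModType R) (f : M -> W) p a u v :
  dfun f p (a *: u + v) = a *: dfun f p u + dfun f p v.
Proof. exact: dfun_is_linear. Qed.

Lemma dfun0 (W : normedModType R) (f : M -> W) p : dfun f p 0 = 0.
Proof. by have := dfunP f p (-1) 0 0; rewrite scaler0 addr0 scaleN1r addNr. Qed.

Lemma smooth_field_lincomb (a : M -> R) X Y : (forall p, msm a p) ->
  smooth_field X -> smooth_field Y -> smooth_field (fun q => a q *: X q + Y q).
Proof.
move=> sa /smooth_fieldP sX /smooth_fieldP sY; apply/smooth_fieldP => c p ac cp.
under eq_fun do rewrite dfunP.
by apply: msm_add; [apply: msm_scale => //; exact: sX|exact: sY].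
Qed.

Lemma smooth_field0 : smooth_field (fun _ : M => 0 : E).
Proof.
apply/smooth_fieldP => c p ac cp; under eq_fun do rewrite dfun0.
exact: msm_cst.
Qed.

Lemma smooth_field_sum m (a : 'I_m -> M -> R) (X : 'I_m -> M -> E) r :
  (forall i p, msm (a i) p) -> (forall i, smooth_field (X i)) ->
  smooth_field (fun q => \sum_(i <- r) a i q *: X i q).
Proof.
move=> sa sX; elim: r => [|i r IH].
  by under eq_fun do rewrite big_nil; exact: smooth_field0.
by under eq_fun do rewrite big_cons; exact: smooth_field_lincomb.
Qed.

Lemma bracketN X Y p : bracket X Y p = - bracket Y X p.
Proof. by rewrite /bracket opprB. Qed.

Lemma bracketPr X Y Z (a : R) p :
  smooth_field X -> smooth_field Y -> smooth_field Z ->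
  bracket X (fun q => a *: Y q + Z q) p = a *: bracket X Y p + bracket X Z p.
Proof.
move=> sX /smooth_fieldP sY /smooth_fieldP sZ; rewrite /bracket.
have ac := @atlas_chart_at _ _ M p; have cp := @mem_chart_at _ _ M p.
set c := chart_at p in ac cp *.
have E1 : 'd (field_in c (fun q => a *: Y q + Z q)) (c p) (X p) =
    a *: 'd (field_in c Y) (c p) (X p) + 'd (field_in c Z) (c p) (X p).
  have E2 : (fun q => dfun c q (a *: Y q + Z q)) =
      fun q => a *: dfun c q (Y q) + dfun c q (Z q).
    by apply/funext => q; exact: dfunP.
  apply: (etrans (congr1 (fun f : M -> E => dfun f p (X p)) E2)).
  have sYc := sY _ _ ac cp; have sZc := sZ _ _ ac cp.
  rewrite dfun_add//; last exact: (msm_scale (msm_cst a p)).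
  by rewrite (dfun_scale _ (msm_cst a p))// dfun_cst scale0r addr0.
have E3 := dfunP (fun q => dfun c q (X q)) p a (Y p) (Z p).
apply: (etrans (congr2 (fun x y => x - y) E1 E3)).
have aux (x y z w : E) : a *: x + y - (a *: z + w) = a *: (x - z) + (y - w).
  by rewrite scalerBr opprD addrACA.
exact: aux.
Qed.

End Fields.

(** * The Lie algebra and left-invariant fields *)

Section LieAlgebra.
Context {R : realType} {n : nat} {G : lieGroupType R n}.
Local Notation E := 'rV[R]_n.
Implicit Types (c d e : chart R n G) (g h p q : G) (u v w : E).
Local Notation lie := (@lie_bracket R n G).

Lemma lieN u v : lie u v = - lie v u.
Proof. exact: bracketN. Qed.

Lemma lie_linear_r u : linear (lie u).
Proof.
move=> a v w; rewrite /lie_bracket.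
have -> : left_field (a *: v + w) =
    (fun q => a *: left_field v q + left_field w q) :> (G -> E).
  by apply/funext => q; exact: left_fieldP.
by apply: bracketPr; exact: smooth_left_field.
Qed.

Lemma lie_linear_l v : linear (lie ^~ v).
Proof.
by move=> a u w /=; rewrite lieN lie_linear_r opprD -scalerN -!lieN.
Qed.

Lemma liexx u : lie u u = 0.
Proof. exact: subrr. Qed.

Lemma lie_frame_l u v : lie u v = \sum_i rv_coord i u *: lie (rv_vec i) v.
Proof. exact: (linear_rv u (lie_linear_l v)). Qed.

Lemma lie_frame_r u v : lie u v = \sum_i rv_coord i v *: lie u (rv_vec i).
Proof. exact: (linear_rv v (lie_linear_r u)). Qed.

(** By [lie_bracketE] the bracket at g is determined by iterated derivatives of a chart c along the
    two fields. Since the fields are left-invariant, these equal the iterated derivatives of c o L_g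
    at 1, where the bracket is [lie u v]. *)
Lemma bracket_left_field u v g :
  bracket (left_field u) (left_field v) g = left_field (lie u v) g.
Proof.
have ac := @atlas_chart_at _ _ G g; have cg := @mem_chart_at _ _ G g.
set c := chart_at g in ac cg *.
have sL w := smooth_left_field (G := G) w.
have sc : msm c g by exact: msm_chart_fun.
have cL : Ltrans g 1%g = g by exact: mulg1.
have scL : msm c (Ltrans g 1%g) by rewrite cL.
have mL q := msmap_Ltrans g q.
have ncL : \forall q \near (1%g : G), cdom c (Ltrans g q).
  by apply: Ltrans_cvg; rewrite cL; exact: near_cdom.
have second u' v' : dfun (fun q => dfun c q (left_field v' q)) g (left_field u'
  g) =
    dfun (fun q => dfun (c \o Ltrans g) q (left_field v' q)) 1%g (left_field u'
      (1%g : G)).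
  have sYc : msm (fun q => dfun c q (left_field v' q)) (Ltrans g 1%g).
    by apply: msm_lie.
  have E0 : tmap (Ltrans g) (1%g : G) (left_field u' (1%g : G)) = left_field u'
    g.
    exact: (etrans (tmap_left_field g 1%g u') (congr1 (left_field u') (mulg1
      g))).
  apply: (etrans (congr2 (dfun (fun q => dfun c q (left_field v' q)))
    (esym cL) (esym E0))).
  apply: (etrans (esym (dfun_msmap (left_field u' (1%g : G)) (mL 1%g) sYc))).
  apply: dfun_eq; last exact: (msm_msmap (mL 1%g) sYc).
  apply: filterS ncL => q cq.
  apply: (etrans _ (esym (dfun_msmap (left_field v' q) (mL q) (msm_chart_fun ac
    cq)))).
  exact: (congr1 (dfun c (Ltrans g q)) (esym (tmap_left_field g q v'))).
have scg := msm_msmap (mL 1%g) scL.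
rewrite -(dfun_chart_at g (bracket _ _ g)).
apply: (etrans (lie_bracketE (sL u) (sL v) sc)).
apply: (etrans (congr2 (fun x y => x - y) (second u v) (second v u))).
apply: (etrans (esym (lie_bracketE (sL u) (sL v) scg))).
apply: (etrans (dfun_msmap _ (mL 1%g) scL)).
rewrite cL; exact: dfun_chart_at.
Qed.

End LieAlgebra.

(** * The connection of a bi-invariant metric *)

Section Trivialisation.
Context {R : realType} {n : nat} {G : lieGroupType R n}.
Local Notation E := 'rV[R]_n.
Local Notation lie := (@lie_bracket R n G).
Implicit Types (c d e : chart R n G) (g h p q : G) (u v w : E).

(** T gives the matrix of v |-> q^-1 v in the chart c. Its entries are partial derivatives in y of
    (x, y) |-> x^-1 y, read in charts and taken on the diagonal, so they are smooth in x. *)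
Lemma near_ltriv c p : atlas c -> cdom c p ->
  exists T : 'I_n -> E -> E, (forall i, smx (T i) (c p)) /\
    \forall q \near p, forall v,
      ltriv q v = \sum_i rv_coord i (dfun c q v) *: T i (c q).
Proof.
move=> ac cp; pose d := chart_at (1%g : G); pose e := chart_at (p^-1)%g.
have ad : atlas d by exact: atlas_chart_at.
have ae : atlas e by exact: atlas_chart_at.
have d1 : cdom d 1%g by exact: mem_chart_at.
have ep : cdom e (p^-1)%g by exact: mem_chart_at.
have dVp : cdom d (p^-1 * p)%g by rewrite mulVg.
have mi := smooth_map_msmap p (@invg_smooth R n G).
pose nu (z : E * E) := d ((cinv c z.1)^-1 * cinv c z.2)%g.
have snu : smx nu (c p, c p).
  have sm := mul_smx ae ac ad ep cp dVp.
  have si : smx (e \o (fun q : G => q^-1)%g \o cinv c) (c p).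
    by have [_ /(msmP _ ac cp)] := mi.
  pose iota (z : E * E) := (e (cinv c z.1)^-1%g, z.2).
  have si2 : smx iota (c p, c p).
    apply: smooth_near_pair; last exact: smx_snd.
    apply: (@smooth_near_comp _ (euclid (E * E)%type) _ rv_frame _
      (fun z => z.1) (e \o (fun q : G => q^-1)%g \o cinv c)) => //.
    exact: smx_fst.
  have n1 : \forall z \near (c p, c p), cdom e (cinv c z.1)^-1%g.
    have [ci _] := mi.
    have H : \forall x \near c p, cdom e (cinv c x)^-1%g.
      have Hq : \forall q \near p, cdom e (q^-1)%g := ci _ (near_cdom ep).
      exact: (near_cinv cp Hq).
    exact: (@cvg_fst _ _ (nbhs (c p)) (nbhs (c p)) _ _ H).
  apply: (@smooth_near_eq _ (euclid (E * E)%type) _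
      (fun z => d (cinv e (iota z).1 * cinv c (iota z).2)%g)).
    by apply: filterS n1 => z ez; rewrite /iota /nu /= cmapK.
  apply: (@smooth_near_comp _ (euclid (E * E)%type) _ rv2_frame _ iota
    (fun z => d (cinv e z.1 * cinv c z.2)%g)) => //.
  by rewrite /iota /= cmapK.
exists (fun i x => 'D_(0, rv_vec i) nu (x, x)); split.
  move=> i; apply: (@smooth_near_comp _ (euclid E) _ rv2_frame _
    (fun x => (x, x)) ('D_(0, rv_vec i) nu)) => //.
    by apply: smooth_near_pair; exact: smx_id.
  exact: (smooth_near_der (C := euclid (E * E)%type) (0, rv_vec i) snu).
have dnu : \forall z \near (c p, c p), differentiable nu z.
  by have [] := snu 0%N.
have dnu2 : \forall x \near c p, differentiable nu (x, x).
  have c2 : {for c p, continuous (fun x : E => (x, x))}.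
    apply/differentiable_continuous/smx_differentiable.
    by apply: smooth_near_pair; exact: smx_id.
  exact: c2 dnu.
apply: filterS2 (near_chart cp dnu2) (near_cdom cp) => q dq cq v.
have qV : Ltrans q^-1%g q = 1%g by exact: mulVg.
have FE : d \o Ltrans q^-1%g \o cinv c = fun y : E => nu (c q, y).
  by apply/funext => x; rewrite /nu /= cmapK.
have [dn2 _] := partial2 (0 : E) dq.
have dF : differentiable ((d \o Ltrans q^-1%g) \o cinv c) (c q).
  exact: (eq_ind_r (fun f : E -> E => differentiable f (c q)) dn2 FE).
(* The definition of [ltriv] refers to the chart at q^-1 q; this is the chart d at 1 fixed in
   advance. *)
have E1 : ltriv q v = dfun (d \o Ltrans q^-1%g) q v.
  exact: (congr1 (fun r => dfun (chart_at r \o Ltrans q^-1%g) q v) qV).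
apply: (etrans E1); apply: (etrans (dfun_chart v ac cq dF)).
apply: (etrans (congr1 (fun f : E -> E => 'd f (c q) (dfun c q v)) FE)).
apply: (etrans (diff_frame rv_frame (dfun c q v) dn2)); apply: eq_bigr => i _.
apply: (congr1 (fun w => _ *: w)); have [_ E2] := partial2 (rv_vec i) dq.
apply: (etrans (deriveE _ dn2)); apply: (etrans E2).
exact: (esym (deriveE _ dq)).
Qed.

Lemma msm_ltriv X p : smooth_field X -> msm (fun q : G => ltriv q (X q)) p.
Proof.
move=> /smooth_fieldP sX.
have ac := @atlas_chart_at _ _ G p; have cp := @mem_chart_at _ _ G p.
have [T [sT nT]] := near_ltriv ac cp; set c := chart_at p in ac cp sT nT.
apply: (@msm_eq _ _ _ _ (fun q => \sum_i
    rv_coord i (dfun c q (X q)) *: T i (c q))).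
  by apply: filterS nT => q ->.
apply: msm_sum => i; apply: msm_scale; first by apply: msm_coord; exact: sX.
exact: msm_chart.
Qed.

Lemma left_field_inj g u v : left_field u g = left_field v g -> u = v.
Proof. by move=> /(congr1 (ltriv g)); rewrite !left_fieldK. Qed.

Lemma msm_lie_bracket (y z : G -> E) p : msm y p -> msm z p ->
  msm (fun q => lie (y q) (z q)) p.
Proof.
move=> sy sz; exact: (@smooth_near_bilin _ _ (euclid E) _
  lie_linear_l lie_linear_r (y \o cinv (chart_at p)) (z \o cinv (chart_at p))
  (chart_at p p) I sy sz).
Qed.

Lemma dfun_lie_bracket (y z : G -> E) p u : msm y p -> msm z p ->
  dfun (fun q => lie (y q) (z q)) p u =
  lie (dfun y p u) (z p) + lie (y p) (dfun z p u).
Proof.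
move=> sy sz; have syz := msm_lie_bracket sy sz.
apply: (etrans (dfunE u syz)).
apply: (etrans (@der_bilin _ _ (euclid E) _ lie_linear_l lie_linear_r
  (y \o cinv (chart_at p)) (z \o cinv (chart_at p)) u (chart_at p p) I sy sz)).
rewrite -(dfunE u sy) -(dfunE u sz).
by rewrite /= cmapK//; exact: mem_chart_at.
Qed.

End Trivialisation.

Section LeviCivita.
Context {R : realType} {n : nat} {G : lieGroupType R n}.
Local Notation E := 'rV[R]_n.
Local Notation lie := (@lie_bracket R n G).
Variables (met : G -> E -> E -> R) (nabla : (G -> E) -> (G -> E) -> G -> E).
Hypothesis met_riem : is_riemannian met.
Hypothesis met_inv : bi_invariant met.
Hypothesis lc : is_levi_civita met nabla.
Implicit Types (g p q : G) (u v w : E) (X Y Z : G -> E).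

Lemma met_left_field g u v :
  met g (left_field u g) (left_field v g) = met 1%g u v.
Proof.
have gE : Ltrans g 1%g = g := mulg1 g.
apply: (etrans _ (met_inv g 1%g u v).1).
exact: (congr1 (fun r => met r (left_field u g) (left_field v g)) (esym gE)).
Qed.

Lemma met_right_field g u v :
  met g (right_field u g) (right_field v g) = met 1%g u v.
Proof.
have gE : Rtrans g 1%g = g := mul1g g.
apply: (etrans _ (met_inv g 1%g u v).2).
exact: (congr1 (fun r => met r (right_field u g) (right_field v g)) (esym gE)).
Qed.

Let sL u : smooth_field (left_field u : G -> E).
Proof. exact: smooth_left_field. Qed.

Lemma nabla_sum_l m (a : 'I_m -> G -> R) (X : 'I_m -> G -> E) Z r p :
  (forall i p, msm (a i) p) -> (forall i, smooth_field (X i)) ->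
  smooth_field Z ->
  nabla (fun q => \sum_(i <- r) a i q *: X i q) Z p =
  \sum_(i <- r) a i p *: nabla (X i) Z p.
Proof.
move=> sa sX sZ; elim: r => [|i r IH].
  rewrite big_nil; under eq_fun do rewrite big_nil.
  have := nablaZl lc (f := fun=> 0) (iffRL (smooth_funP _) (msm_cst 0)) sZ sZ p.
  by under eq_fun do rewrite scale0r; rewrite scale0r.
rewrite big_cons; under eq_fun do rewrite big_cons.
have saf : smooth_fun (a i) by apply/smooth_funP.
have saX : smooth_field (fun q => a i q *: X i q).
  under eq_fun do rewrite -[_ *: _]addr0.
  by apply: smooth_field_lincomb => //; exact: smooth_field0.
rewrite (nablaDl lc)//; last exact: smooth_field_sum.
by rewrite (nablaZl lc)// IH.
Qed.

Lemma nabla_sum_r m (a : 'I_m -> G -> R) (Y : 'I_m -> G -> E) X r p :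
  (forall i p, msm (a i) p) -> (forall i, smooth_field (Y i)) ->
  smooth_field X ->
  nabla X (fun q => \sum_(i <- r) a i q *: Y i q) p =
  \sum_(i <- r) (dfun (a i) p (X p) *: Y i p + a i p *: nabla X (Y i) p).
Proof.
move=> sa sY sX; elim: r => [|i r IH].
  rewrite big_nil; under eq_fun do rewrite big_nil.
  have := nabla_leibniz lc (f := fun=> 0) (iffRL (smooth_funP _) (msm_cst 0))
    sX sX p.
  by under eq_fun do rewrite scale0r; rewrite scale0r dfun_cst scale0r addr0.
rewrite big_cons; under eq_fun do rewrite big_cons.
have saf : smooth_fun (a i) by apply/smooth_funP.
have saX : smooth_field (fun q => a i q *: Y i q).
  under eq_fun do rewrite -[_ *: _]addr0.
  by apply: smooth_field_lincomb => //; exact: smooth_field0.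
rewrite (nablaDr lc)//; last exact: smooth_field_sum.
by rewrite (nabla_leibniz lc)// IH.
Qed.

(** The coefficients are defined on all of G, so the axioms of [nabla], which speak of global fields
    and functions, apply to this expansion with no cutoff functions. *)
Lemma field_frame X :
  X = (fun q => \sum_i rv_coord i (ltriv q (X q)) *: left_field (rv_vec i) q).
Proof. by apply/funext => q; rewrite -left_field_frame ltrivK. Qed.

Lemma nabla_frame_l X Z p : smooth_field X -> smooth_field Z ->
  nabla X Z p =
  \sum_i rv_coord i (ltriv p (X p)) *: nabla (left_field (rv_vec i)) Z p.
Proof.
move=> sX sZ; rewrite {1}(field_frame X).
apply: (nabla_sum_l (a := fun i q => rv_coord i (ltriv q (X q)))
  (X := fun i => left_field (rv_vec i))) => // i q.
by apply: msm_coord; exact: msm_ltriv.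
Qed.

Lemma nabla_frame_r X Y p : smooth_field X -> smooth_field Y ->
  nabla X Y p =
  left_field (dfun (fun q => ltriv q (Y q)) p (X p)) p +
  \sum_i rv_coord i (ltriv p (Y p)) *: nabla X (left_field (rv_vec i)) p.
Proof.
move=> sX sY; rewrite {1}(field_frame Y).
have sy q : msm (fun q => ltriv q (Y q)) q by exact: msm_ltriv.
rewrite (nabla_sum_r (a := fun i q => rv_coord i (ltriv q (Y q)))
  (Y := fun i => left_field (rv_vec i)))//; last by move=> i q;
    exact: msm_coord.
rewrite big_split/= left_field_frame; congr (_ + _).
by apply: eq_bigr => i _; rewrite dfun_coord.
Qed.

Lemma nabla_pointwise X X' Z p : smooth_field X -> smooth_field X' ->
  smooth_field Z -> X p = X' p -> nabla X Z p = nabla X' Z p.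
Proof. by move=> sX sX' sZ XX'; rewrite nabla_frame_l// XX' -nabla_frame_l. Qed.

(* Both the left and the right invariant fields extending a vector have constant
   inner products. At 1, the difference of the two extensions L_u and R_u of u
   satisfies nabla_w (L_u - R_u) = [w, u], because [L_w, R_u] = 0. *)
Lemma lie_skew u v w : met 1%g (lie w u) v + met 1%g u (lie w v) = 0.
Proof.
have sW := sL w; have sR x : smooth_field (right_field x : G -> E).
  exact: smooth_right_field.
have metr x y z : met 1%g x (y + z) = met 1%g x y + met 1%g x z.
  by rewrite !(metC met_riem 1%g x) (metDl met_riem).
have ext x : nabla (left_field w) (left_field x) 1%g =
    lie w x + nabla (left_field w) (right_field x) 1%g.
  have TL : _ = lie w x := nabla_torsion_free lc sW (sL x) 1%g.
  have TR := etrans (nabla_torsion_free lc sW (sR x) 1%g) (bracket_left_right w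
    x).
  have NE : nabla (right_field x) (left_field w) 1%g =
      nabla (left_field x) (left_field w) 1%g.
    apply: (nabla_pointwise (sR x) (sL x) sW).
    exact: (etrans (right_field1 x) (esym (left_field1 x))).
  have aux (a b c d l : E) : a - b = l -> c - d = 0 -> d = b -> a = l + c.
    by move=> <- /subr0_eq -> ->; rewrite subrK.
  exact: (aux _ _ _ _ _ TL TR NE).
have ML := nabla_metric lc sW (sL u) (sL v) 1%g.
have MR := nabla_metric lc sW (sR u) (sR v) 1%g.
have cL : (fun q => met q (left_field u q) (left_field v q)) = fun=>
  met 1%g u v.
  by apply/funext => q; exact: met_left_field.
have cR : (fun q => met q (right_field u q) (right_field v q)) = fun=>
  met 1%g u v.
  by apply/funext => q; exact: met_right_field.
have zero (f : G -> R) r w' : f = (fun=> r) -> dfun f (1%g : G) w' = 0.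
  by move=> ->; exact: dfun_cst.
have {}ML := etrans (esym ML) (zero _ _ _ cL).
have {}MR := etrans (esym MR) (zero _ _ _ cR).
have aux (a b a' b' x y : E) : a = x + a' -> b = y + b' ->
    met 1%g a v + met 1%g u b = 0 -> met 1%g a' v + met 1%g u b' = 0 ->
    met 1%g x v + met 1%g u y = 0.
  move=> -> ->; rewrite (metDl met_riem) metr addrACA.
  by move=> + H; rewrite H addr0.
have subst1 (a b u' v' : E) : u' = u -> v' = v ->
    met 1%g a v' + met 1%g u' b = 0 -> met 1%g a v + met 1%g u b = 0.
  by move=> -> ->.
apply: (aux _ _ _ _ _ _ (ext u) (ext v)).
- exact: (subst1 _ _ _ _ (left_field1 u) (left_field1 v) ML).
- exact: (subst1 _ _ _ _ (right_field1 u) (right_field1 v) MR).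
Qed.

(** T is the form <nabla_x y, z> and C the form <[x, y], z>. Inner products of left-invariant fields
    are constant, so metric compatibility makes T skew in its last two arguments; torsion-freeness
    gives T x y z - T y x z = C x y z; and C is skew in all arguments by [lie_skew]. *)
Lemma nabla_left_field u v p :
  nabla (left_field u) (left_field v) p = 2^-1 *: left_field (lie u v) p.
Proof.
pose T x y z := met p (nabla (left_field x) (left_field y) p) (left_field z p).
pose C x y z := met (1%g : G) (lie x y) z.
have T1 x y z : T x y z + T x z y = 0.
  have M1 := nabla_metric lc (sL x) (sL y) (sL z) p.
  have cL : (fun q => met q (left_field y q) (left_field z q)) = fun=>
    met 1%g y z.
    by apply/funext => q; exact: met_left_field.
  have E1 : dfun (fun q => met q (left_field y q) (left_field z q)) p
    (left_field x p) = 0.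
    by rewrite cL; exact: dfun_cst.
  apply: (etrans (congr1 (fun r => T x y z + r) (metC met_riem p _ _))).
  exact: (etrans (esym M1) E1).
have T2 x y z : T x y z - T y x z = C x y z.
  have TL := etrans (nabla_torsion_free lc (sL x) (sL y) p)
    (bracket_left_field x y p).
  have := congr1 (fun r => met p r (left_field z p)) TL.
  rewrite met_left_field -scaleN1r addrC (metDl met_riem) (metZl met_riem).
  by rewrite mulN1r addrC.
have C1 x y z : C x y z + C x z y = 0.
  by rewrite [X in _ + X](metC met_riem); exact: lie_skew.
have C2 x y z : C x y z + C y x z = 0.
  by rewrite /C lieN -scaleN1r (metZl met_riem) mulN1r addNr.
(* With T and C abstract, the instances of these relations at the permutations of u, v, w are a
   linear system that determines T u v w. *)
have TC w : T u v w = 2^-1 * C u v w.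
  move: T C T1 T2 C1 C2 => T C T1 T2 C1 C2.
  clear - T1 T2 C1 C2.
  have := T1 u v w; have := T2 u w v; have := T1 w u v; have := T2 w v u.
  have := T1 v w u; have := T2 u v w.
  have := C1 u v w; have := C2 u w v; have := C1 w u v; have := C2 w v u.
  have := C1 v w u; have := C2 u v w.
  by lra.
(* The difference D of the two sides is orthogonal to all left-invariant fields at p. Their values
   exhaust the tangent space, so D is orthogonal to itself. *)
apply/eqP; rewrite -subr_eq0; apply/negPn/negP => D0.
have := met_gt0 met_riem p D0; set D := _ - _ in D0 *.
have DE w : met p D (left_field w p) = 0.
  rewrite /D -scaleN1r addrC (metDl met_riem) !(metZl met_riem) met_left_field.
  by rewrite -/(T u v w) TC mulrA mulN1r mulNr addNr.
by rewrite -[X in met p D X](ltrivK p) DE ltxx.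
Qed.

(** Expanding Y in the left frame, the derivatives of its coefficients give the first term;
    expanding X as well, the half brackets of frame fields add up to the second. *)
Lemma nablaE X Y p : smooth_field X -> smooth_field Y ->
  nabla X Y p = left_field (dfun (fun q => ltriv q (Y q)) p (X p) +
    2^-1 *: lie (ltriv p (X p)) (ltriv p (Y p))) p.
Proof.
move=> sX sY; rewrite nabla_frame_r// left_fieldD; congr (_ + _).
rewrite left_fieldZ lie_frame_r.
set x := ltriv p (X p); set y := ltriv p (Y p).
have E1 i : nabla X (left_field (rv_vec i)) p =
    2^-1 *: left_field (lie x (rv_vec i)) p.
  rewrite nabla_frame_l// -/x lie_frame_l.
  have -> : left_field (\sum_j rv_coord j x *: lie (rv_vec j) (rv_vec i)) p =
      \sum_j rv_coord j x *: left_field (lie (rv_vec j) (rv_vec i)) p.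
    elim/big_ind2: _; first exact: left_field0.
      by move=> a b a' b' <- <-; rewrite left_fieldD.
    by move=> j _; rewrite left_fieldZ.
  rewrite scaler_sumr; apply: eq_bigr => j _.
  by rewrite nabla_left_field !scalerA mulrC.
under eq_bigr do rewrite E1.
have -> : left_field (\sum_i rv_coord i y *: lie x (rv_vec i)) p =
    \sum_i rv_coord i y *: left_field (lie x (rv_vec i)) p.
  elim/big_ind2: _; first exact: left_field0.
    by move=> a b a' b' <- <-; rewrite left_fieldD.
  by move=> j _; rewrite left_fieldZ.
by rewrite scaler_sumr; apply: eq_bigr => j _; rewrite !scalerA mulrC.
Qed.

End LeviCivita.

(** * Curvature in the left trivialisation *)

Section Curvature.
Context {R : realType} {n : nat} {G : lieGroupType R n}.
Local Notation E := 'rV[R]_n.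
Local Notation lie := (@lie_bracket R n G).
Variables (met : G -> E -> E -> R) (nabla : (G -> E) -> (G -> E) -> G -> E).
Hypothesis met_riem : is_riemannian met.
Hypothesis met_inv : bi_invariant met.
Hypothesis lc : is_levi_civita met nabla.
Implicit Types (g p q : G) (u v w : E) (X Y Z : G -> E).

Lemma lieDl u v w : lie (u + v) w = lie u w + lie v w.
Proof. by have := lie_linear_l (G := G) w 1 u v; rewrite !scale1r. Qed.

Lemma lieDr u v w : lie w (u + v) = lie w u + lie w v.
Proof. by have := lie_linear_r (G := G) w 1 u v; rewrite !scale1r. Qed.

Lemma lie0r u : lie u 0 = 0.
Proof. by have := lie_linear_r (G := G) u (-1) 0 0;
  rewrite scaler0 addr0 scaleN1r addNr. Qed.

Lemma lieZr a u v : lie u (a *: v) = a *: lie u v.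
Proof. by have := lie_linear_r (G := G) u a v 0; rewrite lie0r !addr0. Qed.

Lemma lieNr u v : lie u (- v) = - lie u v.
Proof. by rewrite -scaleN1r lieZr scaleN1r. Qed.

Lemma lieNl u v : lie (- u) v = - lie u v.
Proof. by rewrite lieN lieNr -lieN. Qed.

Lemma left_fieldN p u : left_field (- u) p = - left_field u p.
Proof. by rewrite -scaleN1r left_fieldZ scaleN1r. Qed.

Let tr X := fun q => ltriv q (X q).

Let ltriv_nabla X Y : smooth_field X -> smooth_field Y ->
  tr (nabla X Y) =
  fun q => dfun (tr Y) q (X q) + 2^-1 *: lie (tr X q) (tr Y q).
Proof.
move=> sX sY; apply/funext => q.
by rewrite /tr (nablaE met_riem met_inv lc)// left_fieldK.
Qed.

Let dfun_tr_nabla X Y p u : smooth_field X -> smooth_field Y ->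
  dfun (tr (nabla X Y)) p u =
  dfun (fun q => dfun (tr Y) q (X q)) p u +
  2^-1 *: (lie (dfun (tr X) p u) (tr Y p) + lie (tr X p) (dfun (tr Y) p u)).
Proof.
move=> sX sY; rewrite ltriv_nabla//.
have sx : msm (tr X) p by exact: msm_ltriv.
have sy : msm (tr Y) p by exact: msm_ltriv.
have sxy : msm (fun q => lie (tr X q) (tr Y q)) p by exact: msm_lie_bracket.
have sc := msm_scale (msm_cst (2^-1 : R) p) sxy.
apply: (etrans (dfun_add u (msm_lie sX sy) sc)); congr (_ + _).
apply: (etrans (dfun_scale u (msm_cst (2^-1 : R) p) sxy)).
by rewrite dfun_cst scale0r addr0 dfun_lie_bracket.
Qed.

Let bracket_nabla X Y : smooth_field X -> smooth_field Y ->
  bracket X Y = fun q => (-1) *: nabla Y X q + nabla X Y q.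
Proof.
move=> sX sY; apply/funext => q.
by rewrite scaleN1r addrC (nabla_torsion_free lc).
Qed.

(** Torsion-freeness exhibits the bracket as a difference of covariant derivatives, which are smooth
    by [nabla_smooth]. *)
Let smooth_bracket X Y : smooth_field X -> smooth_field Y ->
  smooth_field (bracket X Y).
Proof.
move=> sX sY; rewrite bracket_nabla//; apply: smooth_field_lincomb.
- by move=> p; exact: msm_cst.
- exact: (nabla_smooth lc).
- exact: (nabla_smooth lc).
Qed.

(** In the difference of nabla_X Y and nabla_Y X the two half brackets add up to a full one, by
    antisymmetry. *)
Let tr_bracket X Y p : smooth_field X -> smooth_field Y ->
  ltriv p (bracket X Y p) = dfun (tr Y) p (X p) - dfun (tr X) p (Y p)
    + lie (tr X p) (tr Y p).
Proof.
move=> sX sY; apply: (@left_field_inj _ _ _ p); rewrite ltrivK.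
rewrite bracket_nabla// (nablaE met_riem met_inv lc)//.
rewrite (nablaE met_riem met_inv lc)// scaleN1r -left_fieldN -left_fieldD.
congr (left_field _ p); rewrite (lieN (ltriv p (Y p))).
have aux (a b c : E) : - (a + 2^-1 *: - c) + (b + 2^-1 *: c) = b - a + c.
  by apply/rowP => i; rewrite !mxE; lra.
exact: aux.
Qed.

Let nabla_nabla X Y Z p :
  smooth_field X -> smooth_field Y -> smooth_field Z ->
  nabla X (nabla Y Z) p = left_field
    (dfun (fun q => dfun (tr Z) q (Y q)) p (X p) +
     2^-1 *: (lie (dfun (tr Y) p (X p)) (tr Z p) +
              lie (tr Y p) (dfun (tr Z) p (X p))) +
     2^-1 *: lie (tr X p) (dfun (tr Z) p (Y p) +
                           2^-1 *: lie (tr Y p) (tr Z p))) p.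
Proof.
move=> sX sY sZ.
have sYZ := nabla_smooth lc sY sZ.
apply: (etrans (nablaE met_riem met_inv lc p sX sYZ)).
exact: (congr2 (fun a b => left_field (a + 2^-1 *: lie (tr X p) b) p)
  (dfun_tr_nabla p (X p) sY sZ) (congr1 (@^~ p) (ltriv_nabla sY sZ))).
Qed.

Let nabla_bracket X Y Z p :
  smooth_field X -> smooth_field Y -> smooth_field Z ->
  nabla (bracket X Y) Z p = left_field
    (dfun (fun q => dfun (tr Z) q (Y q)) p (X p) -
     dfun (fun q => dfun (tr Z) q (X q)) p (Y p) +
     2^-1 *: lie (dfun (tr Y) p (X p) - dfun (tr X) p (Y p) +
                  lie (tr X p) (tr Y p)) (tr Z p)) p.
Proof.
move=> sX sY sZ; have sXY := smooth_bracket sX sY.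
have sz : msm (tr Z) p by exact: msm_ltriv.
apply: (etrans (nablaE met_riem met_inv lc p sXY sZ)).
exact: (congr2 (fun a b => left_field (a + 2^-1 *: lie b (tr Z p)) p)
  (lie_bracketE sX sY sz) (tr_bracket p sX sY)).
Qed.

(** Here yX stands for the derivative of y along X, similarly zX, zY and xY, while A and B are the
    second derivatives X (Y z) and Y (X z). All terms containing derivatives cancel. *)
Let curvature_algebra (A yX zX zY B xY x y z : E) p :
  left_field (A + 2^-1 *: (lie yX z + lie y zX) +
              2^-1 *: lie x (zY + 2^-1 *: lie y z)) p -
  left_field (B + 2^-1 *: (lie xY z + lie x zY) +
              2^-1 *: lie y (zX + 2^-1 *: lie x z)) p -
  left_field (A - B + 2^-1 *: lie (yX - xY + lie x y) z) p =
  left_field (4^-1 *: lie x (lie y z) - 4^-1 *: lie y (lie x z) -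
              2^-1 *: lie (lie x y) z) p.
Proof.
rewrite -!left_fieldN -!left_fieldD; congr (left_field _ p).
rewrite (lieDr zY (2^-1 *: lie y z)) (lieDr zX (2^-1 *: lie x z)).
rewrite (lieZr _ x (lie y z)) (lieZr _ y (lie x z)).
rewrite (lieDl (yX - xY) (lie x y)) (lieDl yX (- xY)) (lieNl xY).
have aux (P Q S U T T' K : E) :
  A + 2^-1 *: (P + Q) + 2^-1 *: (S + 2^-1 *: T)
  - (B + 2^-1 *: (U + S) + 2^-1 *: (Q + 2^-1 *: T'))
  - (A - B + 2^-1 *: (P - U + K)) = 4^-1 *: T - 4^-1 *: T' - 2^-1 *: K.
  apply/rowP => i; rewrite !mxE.
  move: (A 0 i) (B 0 i) (P 0 i) (Q 0 i) (S 0 i) (U 0 i) (T 0 i) (T' 0 i) (K 0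
    i).
  by move=> *; field.
exact: aux.
Qed.

Let curvature_formula X Y Z p :
  smooth_field X -> smooth_field Y -> smooth_field Z ->
  nabla X (nabla Y Z) p - nabla Y (nabla X Z) p - nabla (bracket X Y) Z p =
  left_field (4^-1 *: lie (tr X p) (lie (tr Y p) (tr Z p)) -
    4^-1 *: lie (tr Y p) (lie (tr X p) (tr Z p)) -
    2^-1 *: lie (lie (tr X p) (tr Y p)) (tr Z p)) p.
Proof.
move=> sX sY sZ.
apply: (etrans (congr2 (fun a b => a - b) (congr2 (fun a b => a - b)
  (nabla_nabla p sX sY sZ) (nabla_nabla p sY sX sZ)) (nabla_bracket p sX sY
    sZ))).
exact: curvature_algebra.
Qed.

(** The formula involves the fields only through their values at p, so all extensions of the three
    vectors yield the same result; the left-invariant extensions show that there is one. *)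
Lemma curvature_left_field x y z p :
  curvature nabla p (left_field x p) (left_field y p) (left_field z p) =
  left_field (4^-1 *: lie x (lie y z) - 4^-1 *: lie y (lie x z) -
    2^-1 *: lie (lie x y) z) p.
Proof.
rewrite /curvature; apply: xget_subset1.
  exists (left_field x), (left_field y), (left_field z).
  split; try exact: smooth_left_field.
  split=> //; rewrite curvature_formula; try exact: smooth_left_field.
  by rewrite /tr !left_fieldK.
move=> r s [X [Y [Z [sX sY sZ [Xp Yp Zp ->]]]]].
move=> [X' [Y' [Z' [sX' sY' sZ' [Xp' Yp' Zp' ->]]]]].
rewrite curvature_formula// [RHS]curvature_formula//.
by rewrite /tr Xp Yp Zp Xp' Yp' Zp'.
Qed.

End Curvature.

(** * Curves and covariant derivatives *)

Section Curves.
Context {R : realType} {n : nat} {a b : R}.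
Hypothesis ab : a < b.
Local Notation E := 'rV[R]_n.
Local Notation I := `[a, b]%classic.
Local Notation CI := (curve_calc (perfect_itv ab)).

Section OneManifold.
Context {M : manifoldType R n}.
Implicit Types (c d : chart R n M) (g : R -> M) (Y : R -> E)
  (W : normedModType R).

Lemma curve_cvg g t : {within I, continuous g} -> I t ->
  g @ within I (nbhs t) --> g t.
Proof. by move=> gc It; rewrite (nbhs_subspace_in It); exact: gc. Qed.

Lemma near_curve g t (P : set M) : {within I, continuous g} -> I t ->
  (\forall q \near g t, P q) -> within I (nbhs t) (fun s => P (g s)).
Proof. by move=> gc It /(curve_cvg gc It). Qed.

Let subI c g : I `&` g @^-1` cdom c `<=` I.
Proof. by move=> t []. Qed.

Let openI c g t : {within I, continuous g} -> (I `&` g @^-1` cdom c) t ->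
  within I (nbhs t) (I `&` g @^-1` cdom c).
Proof.
move=> gc [It ct]; apply: filterI; first exact: withinT.
exact: near_curve gc It (near_cdom ct).
Qed.

Lemma smooth_curveP g : smooth_curve I g <-> {within I, continuous g} /\
  forall c t, atlas c -> I t -> cdom c (g t) ->
    smooth_near (C := CI) (c \o g) t.
Proof.
split=> -[gc sg]; split=> //.
  move=> c t ac It ct.
  have H := (smooth_withinP (perfect_itv ab) (c \o g) (@subI c g)
    (fun t => @openI c g t gc)).1 (sg c ac) t.
  exact: H (conj It ct).
move=> c ac; apply/(smooth_withinP (perfect_itv ab) (c \o g) (@subI c g)
  (fun t => @openI c g t gc)) => t [It ct].
exact: sg.
Qed.

Lemma smooth_alongP g Y : {within I, continuous g} -> smooth_along I g Y <->
  forall c t, atlas c -> I t -> cdom c (g t) ->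
    smooth_near (C := CI) (fun s => dfun c (g s) (Y s)) t.
Proof.
move=> gc; split=> sY.
  move=> c t ac It ct.
  have H := (smooth_withinP (perfect_itv ab) (fun s => dfun c (g s) (Y s))
    (@subI c g) (fun t => @openI c g t gc)).1 (sY c ac) t.
  exact: H (conj It ct).
move=> c ac; apply/(smooth_withinP (perfect_itv ab)
  (fun s => dfun c (g s) (Y s)) (@subI c g) (fun t => @openI c g t gc)).
by move=> t [It ct]; exact: sY.
Qed.

Lemma smooth_within_itvP W (f : R -> W) : smooth_within I f <->
  forall t, I t -> smooth_near (C := CI) f t.
Proof.
apply: smooth_withinP => // t It.
exact: withinT.
Qed.

Lemma near_curve_chart W (f : M -> W) c g t : {within I, continuous g} ->
  I t -> cdom c (g t) ->
  within I (nbhs t) (fun s => (f \o cinv c) ((c \o g) s) = (f \o g) s).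
Proof.
move=> gc It ct; apply: filterS (near_curve gc It (near_cdom ct)) => s cs /=.
by rewrite cmapK.
Qed.

Lemma smooth_near_curve W (f : M -> W) g t : smooth_curve I g -> I t ->
  msm f (g t) -> smooth_near (C := CI) (f \o g) t.
Proof.
move=> /smooth_curveP[gc sg] It sf.
have ac := @atlas_chart_at _ _ M (g t); have ct := @mem_chart_at _ _ M (g t).
apply: (@smooth_near_eq _ CI W
  (fun s => (f \o cinv (chart_at (g t))) ((chart_at (g t) \o g) s))).
  exact: near_curve_chart.
exact: (@smooth_near_comp _ CI _ rv_frame _ (chart_at (g t) \o g)
  (f \o cinv (chart_at (g t))) t It (sg _ _ ac It ct) sf).
Qed.

Lemma deriv_curve W (f : M -> W) g t : smooth_curve I g -> I t ->
  msm f (g t) -> deriv_within I (f \o g) t = dfun f (g t) (velocity I g t).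
Proof.
move=> sg It sf; have [gc sg'] := (smooth_curveP g).1 sg.
have ac := @atlas_chart_at _ _ M (g t); have ct := @mem_chart_at _ _ M (g t).
set c := chart_at (g t) in ac ct.
have scg := sg' c t ac It ct.
have dcg : dif (d := CI) (c \o g) t by exact: (smooth_near_dif (C :=
  CI) It scg).
have df : differentiable (f \o cinv c) ((c \o g) t).
  exact: (smx_differentiable sf).
have dfcg := dif_comp (d := CI) It dcg df.
apply: (etrans (esym (der_eq (d := CI) tt It (near_curve_chart f gc It ct)
  dfcg))).
exact: (der_comp (d := CI) tt It dcg df).
Qed.

(** For s near t the components of the velocity in a fixed chart c are the derivative of c o g at s,
    although the velocity at s is computed in [chart_at (g s)]. *)
Lemma smooth_along_velocity g : smooth_curve I g ->
  smooth_along I g (velocity I g).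
Proof.
move=> sg; have [gc sg'] := (smooth_curveP g).1 sg.
apply/smooth_alongP => // c t ac It ct.
apply: (@smooth_near_eq _ CI E (deriv_within I (c \o g))).
  have H := near_curve gc It (near_cdom ct).
  apply: filterS (filterI (withinT I (nbhs_filter t)) H) => s [Is cs].
  by apply: deriv_curve => //; exact: msm_chart_fun.
exact: (smooth_near_der (C := CI) tt (sg' c t ac It ct)).
Qed.

End OneManifold.

Section Map.
Context {M N : manifoldType R n} (F : M -> N).
Hypothesis mF : forall p, msmap F p.

Lemma velocity_map g t : smooth_curve I g -> I t ->
  velocity I (F \o g) t = tmap F (g t) (velocity I g t).
Proof.
by move=> sg It; have [_ sF] := mF (g t); exact: (deriv_curve sg It sF).
Qed.

Lemma smooth_curve_map g : smooth_curve I g -> smooth_curve I (F \o g).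
Proof.
move=> sg; have [gc _] := (smooth_curveP g).1 sg.
apply/smooth_curveP; split.
  move=> t; apply: (@continuous_comp (subspace I) M N g F t (gc t)).
  by have [] := mF (g t).
move=> c t ac It ct; apply: (smooth_near_curve (f := c \o F) sg It).
by apply: msm_msmap => //; exact: msm_chart_fun.
Qed.

End Map.
End Curves.

(** * The covariant derivative in the left trivialisation *)

Section CovariantDerivative.
Context {R : realType} {n : nat} {G : lieGroupType R n}.
Local Notation E := 'rV[R]_n.
Local Notation lie := (@lie_bracket R n G).
Variables (met : G -> E -> E -> R) (nabla : (G -> E) -> (G -> E) -> G -> E).
Hypothesis met_riem : is_riemannian met.
Hypothesis met_inv : bi_invariant met.
Hypothesis lc : is_levi_civita met nabla.
Variables (a b : R) (g : R -> G).
Hypothesis ab : a < b.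
Local Notation I := `[a, b]%classic.
Local Notation CI := (curve_calc (perfect_itv ab)).
Hypothesis sg : smooth_curve I g.
Implicit Types (Y : R -> E) (t : R).

Let gc : {within I, continuous g}.
Proof. by have [] := (smooth_curveP ab g).1 sg. Qed.

Let curve_triv Y := fun s => ltriv (g s) (Y s).

Let xi := left_velocity I g.

(** The smooth matrix of [near_ltriv] converts chart components into the left trivialisation; the
    smooth left-invariant frame converts back. *)
Lemma smooth_along_ltriv Y : smooth_along I g Y <->
  forall t, I t -> smooth_near (C := CI) (curve_triv Y) t.
Proof.
have sg' := ((smooth_curveP ab g).1 sg).2.
split=> [/(smooth_alongP ab Y gc) sY t It|sY].
  have ac := @atlas_chart_at _ _ G (g t); have ct := @mem_chart_at _ _ G (g t).
  have [T [sT nT]] := near_ltriv ac ct; set c := chart_at (g t) in ac ct sT nT.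
  apply: (@smooth_near_eq _ CI E (fun s => \sum_i
      rv_coord i (dfun c (g s) (Y s)) *: T i ((c \o g) s))).
    by apply: filterS (near_curve gc It nT) => s H; exact: (esym (H (Y s))).
  apply: smooth_near_sum => i; apply: smooth_near_scale.
    by apply: smooth_near_coord; exact: sY.
  exact: (@smooth_near_comp _ CI _ rv_frame _ (c \o g) (T i) t It
    (sg' c t ac It ct) (sT i)).
apply/(smooth_alongP ab Y gc) => c t ac It ct.
apply: (@smooth_near_eq _ CI E (fun s => \sum_i
    rv_coord i (curve_triv Y s) *: dfun c (g s) (left_field (rv_vec i) (g s)))).
  apply: filterE => s; rewrite -[in RHS](ltrivK (g s) (Y s)).
  rewrite (linear_rv (ltriv (g s) (Y s)) (h := fun u =>
    dfun c (g s) (left_field u (g s))))//.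
  by move=> k u v; rewrite left_fieldP dfunP.
apply: smooth_near_sum => i; apply: smooth_near_scale.
  by apply: smooth_near_coord; exact: sY.
have /smooth_fieldP sL := smooth_left_field (G := G) (rv_vec i).
exact: (smooth_near_curve ab sg It (sL c (g t) ac ct)).
Qed.

Let D Y t := left_field (deriv_within I (curve_triv Y) t +
  2^-1 *: lie (xi t) (curve_triv Y t)) (g t).

Let smooth_xi t : I t -> smooth_near (C := CI) xi t.
Proof. by move: t; apply/smooth_along_ltriv; exact: smooth_along_velocity. Qed.

Let smooth_near_lie (y z : R -> E) t : I t -> smooth_near (C := CI) y t ->
  smooth_near (C := CI) z t -> smooth_near (C := CI) (fun s =>
    lie (y s) (z s)) t.
Proof.
move=> It sy sz.
exact: (@smooth_near_bilin _ _ CI _ lie_linear_l lie_linear_r y z t It sy sz).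
Qed.

Let smooth_D_triv (y : R -> E) t : I t -> smooth_near (C := CI) y t ->
  smooth_near (C := CI) (fun s => deriv_within I y s + 2^-1 *: lie (xi s) (y
    s)) t.
Proof.
move=> It sy; apply: smooth_near_add.
  exact: (smooth_near_der (C := CI) tt sy).
apply: smooth_near_scale; first exact: smooth_near_cst.
by apply: smooth_near_lie => //; exact: smooth_xi.
Qed.

Let D_triv Y s : curve_triv (D Y) s =
  deriv_within I (curve_triv Y) s + 2^-1 *: lie (xi s) (curve_triv Y s).
Proof. exact: left_fieldK. Qed.

Let ltrivP (q : G) k u v : ltriv q (k *: u + v) = k *: ltriv q u + ltriv q v.
Proof. exact: tmap_is_linear. Qed.

Let ltrivD (q : G) u v : ltriv q (u + v) = ltriv q u + ltriv q v.
Proof. by have := ltrivP q 1 u v; rewrite !scale1r. Qed.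

Let ltriv0 (q : G) : ltriv q 0 = 0.
Proof. by have := ltrivP q (-1) 0 0; rewrite scaler0 addr0 scaleN1r addNr. Qed.

Let ltrivZ (q : G) k u : ltriv q (k *: u) = k *: ltriv q u.
Proof. by have := ltrivP q k u 0; rewrite ltriv0 !addr0. Qed.

(** Existence: without a witness, the choice made in [covD] would return its default value. *)
Lemma left_covariant_derivative : is_covariant_derivative nabla I g D.
Proof.
split.
- move=> Y /smooth_along_ltriv sY; apply/smooth_along_ltriv => t It.
  apply: (@smooth_near_eq _ CI E (fun s => deriv_within I (curve_triv Y) s +
      2^-1 *: lie (xi s) (curve_triv Y s))).
    by apply: filterE => s; rewrite D_triv.
  exact: smooth_D_triv It (sY t It).
- move=> Y Z /smooth_along_ltriv sY /smooth_along_ltriv sZ t It.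
  have dY : dif (d := CI) (curve_triv Y) t := smooth_near_dif (C :=
    CI) It (sY t It).
  have dZ : dif (d := CI) (curve_triv Z) t := smooth_near_dif (C :=
    CI) It (sZ t It).
  have E1 : curve_triv (fun s => Y s + Z s) = fun s =>
    curve_triv Y s + curve_triv Z s.
    by apply/funext => s; exact: ltrivD.
  have E2 : deriv_within I (fun s => curve_triv Y s + curve_triv Z s) t =
      deriv_within I (curve_triv Y) t + deriv_within I (curve_triv Z) t.
    exact: (derD (C := CI) tt It dY dZ).
  rewrite /D -left_fieldD E1 E2; congr (left_field _ (g t)).
  by rewrite lieDr scalerDr addrACA.
- move=> f Y /(smooth_within_itvP ab) sf /smooth_along_ltriv sY t It.
  have df : dif (d := CI) f t := smooth_near_dif (C := CI) It (sf t It).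
  have dY : dif (d := CI) (curve_triv Y) t := smooth_near_dif (C :=
    CI) It (sY t It).
  have E1 : curve_triv (fun s => f s *: Y s) = fun s => f s *: curve_triv Y s.
    by apply/funext => s; exact: ltrivZ.
  have E2 : deriv_within I (fun s => f s *: curve_triv Y s) t =
      f t *: deriv_within I (curve_triv Y) t + deriv_within I f t *: curve_triv
        Y t.
    exact: (der_scale (C := CI) tt It df dY).
  have aux (k k' : R) (y y' l v : E) : left_field y (g t) = v ->
      left_field (k *: y' + k' *: y + 2^-1 *: (k *: l)) (g t) =
      k' *: v + k *: left_field (y' + 2^-1 *: l) (g t).
    move=> <-; rewrite -!left_fieldZ -left_fieldD; congr (left_field _ (g t)).
    by apply/rowP => i; rewrite !mxE; ring.
  by rewrite /D E1 E2 lieZr; exact: aux (ltrivK _ _).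
- move=> X Y sX YX t It Z sZ ZE.
  rewrite (nablaE met_riem met_inv lc (g t) sZ sX) ZE.
  have E2 : curve_triv Y t = ltriv (g t) (X (g t)) by rewrite /curve_triv YX.
  have E1 : deriv_within I (curve_triv Y) t =
      dfun (fun q => ltriv q (X q)) (g t) (velocity I g t).
    apply: (etrans _ (deriv_curve ab sg It (msm_ltriv (g t) sX))).
    rewrite /deriv_within (@dquot_eq _ _ _ _ ((fun q => ltriv q (X q)) \o g))//.
    apply: filterS (withinT I (nbhs_filter t)) => s Is.
    by rewrite /curve_triv YX.
  exact: (congr2 (fun A B => left_field (A + 2^-1 *: lie (xi t) B) (g t)) E1
    E2).
Qed.

Lemma smooth_along_field X : smooth_field X -> smooth_along I g (fun s =>
  X (g s)).
Proof.
move=> sX; apply/smooth_along_ltriv => t It.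
exact: (smooth_near_curve ab sg It (msm_ltriv (g t) sX)).
Qed.

Lemma smooth_along_comb (f : R -> R) Y Z : smooth_within I f ->
  smooth_along I g Y -> smooth_along I g Z ->
  smooth_along I g (fun s => f s *: Y s + Z s).
Proof.
move=> /(smooth_within_itvP ab) sf /smooth_along_ltriv sY /smooth_along_ltriv
  sZ.
apply/smooth_along_ltriv => t It.
apply: (@smooth_near_eq _ CI E (fun s => f s *: curve_triv Y s + curve_triv Z
  s)).
  by apply: filterE => s; rewrite /curve_triv ltrivP.
by apply: smooth_near_add; [apply: smooth_near_scale;
  [exact: sf|exact: sY]|exact: sZ].
Qed.

Section Uniqueness.
Variable D' : (R -> E) -> R -> E.
Hypothesis covD' : is_covariant_derivative nabla I g D'.

Let zero_along : smooth_along I g (fun=> 0).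
Proof. exact: smooth_along_field smooth_field0. Qed.

Lemma covariant_derivative_zero Y t : (forall s, I s -> Y s = 0) -> I t ->
  D' Y t = 0.
Proof.
move=> Y0 It.
have sL := smooth_left_field (G := G) (xi t).
rewrite (covD_extendible covD' smooth_field0 Y0 It sL); last exact: ltrivK.
rewrite (nablaE met_riem met_inv lc (g t) sL smooth_field0).
have -> : (fun q : G => ltriv q 0) = fun=> 0 by apply/funext => q;
  exact: ltriv0.
by rewrite dfun_cst ltriv0 lie0r scaler0 addr0 left_field0.
Qed.

Lemma covariant_derivative_sum m (y : 'I_m -> R -> R) (X : 'I_m -> G -> E) r t :
  (forall i, smooth_within I (y i)) -> (forall i, smooth_field (X i)) -> I t ->
  D' (fun s => \sum_(i <- r) y i s *: X i (g s)) t =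
  \sum_(i <- r) (deriv_within I (y i) t *: X i (g t) +
                 y i t *: nabla (left_field (xi t)) (X i) (g t)).
Proof.
move=> sy sX It.
have sXg i : smooth_along I g (fun s => X i (g s)) by exact: smooth_along_field.
have syX i : smooth_along I g (fun s => y i s *: X i (g s)).
  have -> : (fun s => y i s *: X i (g s)) = fun s => y i s *: X i (g s) + 0.
    by apply/funext => s; exact: (esym (addr0 _)).
  exact: (smooth_along_comb (sy i) (sXg i) zero_along).
pose S r' s : E := \sum_(i <- r') y i s *: X i (g s).
have S0 : S [::] = fun=> 0 by apply/funext => s; exact: big_nil.
have S1 i r' : S (i :: r') = fun s => y i s *: X i (g s) + S r' s.
  by apply/funext => s; exact: big_cons.
have ssum r' : smooth_along I g (S r').
  elim: r' => [|i r' IH]; first by rewrite S0; exact: zero_along.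
  by rewrite S1; exact: (smooth_along_comb (sy i) (sXg i) IH).
rewrite -/(S r); elim: r => [|i r IH].
  rewrite big_nil; apply: covariant_derivative_zero It => s _.
  by rewrite S0.
rewrite big_cons -IH S1.
rewrite (covDD covD' (syX i) (ssum r))//; congr (_ + _).
rewrite (covD_leibniz covD' (sy i) (sXg i))//; congr (_ + _ *: _).
(* The left-invariant field of xi t serves as the field whose value at g t is the velocity. *)
apply: (covD_extendible covD' (sX i)) => //; first exact: smooth_left_field.
exact: ltrivK.
Qed.

(** Uniqueness: Y is a combination of the left frame along g. Each frame field is extendible, so the
    axioms fix its derivative, and the Leibniz rule accounts for the coefficients. *)
Lemma covariant_derivativeE Y t : smooth_along I g Y -> I t -> D' Y t = D Y t.
Proof.
move=> sY It.
have sy := (smooth_along_ltriv Y).1 sY.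
pose y i s := rv_coord i (curve_triv Y s).
have syi i : smooth_within I (y i).
  by apply/(smooth_within_itvP ab) => s Is; apply: smooth_near_coord; exact: sy.
have {1}-> : Y = fun s => \sum_i y i s *: left_field (rv_vec i) (g s).
  by apply/funext => s; rewrite /y -left_field_frame ltrivK.
rewrite (covariant_derivative_sum _ syi (fun i =>
  smooth_left_field (rv_vec i)) It).
rewrite big_split/= /D left_fieldD; congr (_ + _).
  rewrite [RHS]left_field_frame; apply: eq_bigr => i _; congr (_ *: _).
  have dy : dif (d := CI) (curve_triv Y) t := smooth_near_dif (C :=
    CI) It (sy t It).
  exact: (der_lin (C := CI) tt (@coord_is_continuous R n i) It dy).
rewrite left_fieldZ.
under eq_bigr do rewrite (nabla_left_field met_riem met_inv lc) scalerA mulrC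
  -scalerA.
rewrite -scaler_sumr; congr (_ *: _).
have lin : linear (fun v => left_field (lie (xi t) v) (g t)).
  by move=> k u v; rewrite lie_linear_r left_fieldP.
exact: (esym (linear_rv (curve_triv Y t) lin)).
Qed.

End Uniqueness.

Local Notation Dt := (covD nabla I g).

Lemma covD_spec : is_covariant_derivative nabla I g Dt.
Proof. exact: (xgetPex _ (ex_intro _ D left_covariant_derivative)). Qed.

(** The function y need only represent Y on I, since derivatives relative to I do not see other
    values. Formulas proved on I alone can therefore be fed back in, which allows the iteration up
    to D_t^3. *)
Lemma ltriv_covD Y (y : R -> E) t : smooth_along I g Y ->
  (forall s, I s -> ltriv (g s) (Y s) = y s) -> I t ->
  ltriv (g t) (Dt Y t) = deriv_within I y t + 2^-1 *: lie (xi t) (y t).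
Proof.
move=> sY Yy It; rewrite (covariant_derivativeE covD_spec sY It).
apply: (etrans (left_fieldK _ _)); rewrite /curve_triv (Yy t It).
have E1 : dquot I (curve_triv Y) t = dquot I y t.
  apply: dquot_eq It _.
  by apply: filterS (withinT I (nbhs_filter t)) => s Is; exact: Yy.
exact: (congr1 (fun F => lim F + 2^-1 *: lie (xi t) (y t)) E1).
Qed.

Lemma smooth_near_deriv_within (y : R -> E) t : smooth_near (C := CI) y t ->
  smooth_near (C := CI) (deriv_within I y) t.
Proof. exact: (smooth_near_der (C := CI) tt). Qed.

Lemma second_order_left t : I t ->
  Dt (Dt (Dt (velocity I g))) t +
    curvature nabla (g t) (Dt (velocity I g) t) (velocity I g t) (velocity I g
      t)
  = left_field (derivn_within I 3 xi t + lie (xi t) (derivn_within I 2 xi t))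
    (g t).
Proof.
move=> It; have sv := smooth_along_velocity ab sg.
have sDv := covD_smooth covD_spec sv; have sDDv := covD_smooth covD_spec sDv.
pose xi1 := deriv_within I xi; pose xi2 := deriv_within I xi1.
have E1 s : I s -> ltriv (g s) (Dt (velocity I g) s) = xi1 s.
  move=> Is; rewrite (ltriv_covD (y := xi) sv)// liexx scaler0 addr0.
  by [].
have E2 s : I s -> ltriv (g s) (Dt (Dt (velocity I g)) s) =
    xi2 s + 2^-1 *: lie (xi s) (xi1 s).
  by move=> Is; rewrite (ltriv_covD sDv E1).
have E3 : ltriv (g t) (Dt (Dt (Dt (velocity I g))) t) =
    derivn_within I 3 xi t + lie (xi t) (xi2 t) +
    4^-1 *: lie (xi t) (lie (xi t) (xi1 t)).
  rewrite (ltriv_covD sDDv E2 It).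
  have s0 := smooth_xi It; have s1 := smooth_near_deriv_within s0.
  have s2 := smooth_near_deriv_within s1; have s01 := smooth_near_lie It s0 s1.
  have d2 : dif (d := CI) xi2 t := smooth_near_dif (C := CI) It s2.
  have d01 : dif (d := CI) (fun s => lie (xi s) (xi1 s)) t.
    exact: (smooth_near_dif (C := CI) It s01).
  have dc : dif (d := CI) (fun=> 2^-1 : R) t by exact: dif_cst.
  have F1 : deriv_within I (fun s => lie (xi s) (xi1 s)) t =
      lie (xi1 t) (xi1 t) + lie (xi t) (xi2 t).
    exact: (@der_bilin _ _ CI _ lie_linear_l lie_linear_r xi xi1 tt t It s0 s1).
  have F2 : deriv_within I (fun s => 2^-1 *: lie (xi s) (xi1 s)) t =
      2^-1 *: lie (xi t) (xi2 t).
    apply: (etrans (der_scale (C := CI) tt It dc d01)).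
    rewrite (der_cst (d := CI) (2^-1 : R) tt It) scale0r addr0.
    by apply: (congr1 (fun v => _ *: v)); apply: (etrans F1);
      rewrite liexx add0r.
  have F3 : deriv_within I (fun s => xi2 s + 2^-1 *: lie (xi s) (xi1 s)) t =
      derivn_within I 3 xi t + 2^-1 *: lie (xi t) (xi2 t).
    apply: (etrans (derD (C := CI) tt It d2 (dif_scale (C := CI) It dc d01))).
    exact: (congr1 (fun v => derivn_within I 3 xi t + v) F2).
  rewrite F3 (lieDr (xi2 t) (2^-1 *: lie (xi t) (xi1 t))) (lieZr _ (xi t)).
  (* One half of [xi, xi''] comes from differentiating [xi, xi'] / 2 and the other from the bracket
     term of the third D_t, which also contributes the nested bracket with coefficient 1/4. *)
  have aux (A B K : E) : A + 2^-1 *: B + 2^-1 *: (B + 2^-1 *: K) =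
      A + B + 4^-1 *: K.
    by apply/rowP => i; rewrite !mxE; field.
  exact: aux.
rewrite -(ltrivK (g t) (Dt (Dt (Dt (velocity I g))) t)) E3.
rewrite -(ltrivK (g t) (Dt (velocity I g) t)) (E1 t It).
rewrite -(ltrivK (g t) (velocity I g t)) -/(xi t).
rewrite (curvature_left_field met_riem met_inv lc) liexx lie0r scaler0 add0r.
pose K := lie (xi t) (lie (xi t) (xi1 t)).
(* With x = xi' and y = z = xi the first curvature term has already vanished. The other two are K /
   4 and - K / 2, which together cancel the K / 4 found above. *)
have C1 : lie (xi t) (lie (xi1 t) (xi t)) = - K.
  by rewrite (lieN (xi1 t) (xi t)) (lieNr (xi t)).
have C2 : lie (lie (xi1 t) (xi t)) (xi t) = K by rewrite lieN C1 opprK.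
rewrite C1 C2 -/K -left_fieldD; congr (left_field _ (g t)).
have aux (A B : E) : A + 4^-1 *: B + (- (4^-1 *: - B) - 2^-1 *: B) = A.
  by apply/rowP => i; rewrite !mxE; field.
exact: aux.
Qed.

End CovariantDerivative.

(** * Gradients and left translations *)

Section Gradient.
Context {R : realType} {n : nat} {G : lieGroupType R n}.
Local Notation E := 'rV[R]_n.
Variable met : G -> E -> E -> R.
Hypothesis met_riem : is_riemannian met.
Hypothesis met_inv : bi_invariant met.
Implicit Types (f : G -> R) (k p : G) (u w : E).

Lemma met_inj p u v : (forall w, met p u w = met p v w) -> u = v.
Proof.
move=> uv; apply/eqP; rewrite -subr_eq0; apply/negPn/negP => d0.
have := met_gt0 met_riem p d0.
have -> : met p (u - v) (u - v) = 0; last by rewrite ltxx.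
rewrite -{1}(scaleN1r v) (metDl met_riem) (metZl met_riem) uv.
by rewrite mulN1r subrr.
Qed.

Lemma grad_eq f p u : (forall w, met p u w = dfun f p w) -> grad met f p = u.
Proof.
move=> uP; apply: xget_subset1 => // v w vP wP.
by apply: (@met_inj p) => x; rewrite vP wP.
Qed.

Lemma grad_Ltrans f k p : msm f (Ltrans k p) ->
  grad met f (Ltrans k p) = tmap (Ltrans k) p (grad met (f \o Ltrans k) p).
Proof.
move=> sf; have dk u := dfun_msmap u (msmap_Ltrans k p) sf.
have kK w : tmap (Ltrans k) p (tmap (Ltrans k^-1%g) (k * p)%g w) = w.
  have := tmap_Ltrans k k^-1%g (k * p)%g w.
  by rewrite mulKg mulgV tmap_Ltrans1.
(* By definition [grad] is 0 if no vector represents the differential. Left translation being an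
   invertible isometry, this happens on both sides or on neither, and in the former case both sides
   are 0. *)
case: (pselect (exists u, forall w, met p u w = dfun (f \o Ltrans k) p w)).
  move=> [u uP]; rewrite (grad_eq uP); apply: grad_eq => w.
  rewrite -(kK w); apply: (etrans (met_inv k p _ _).1).
  by rewrite uP dk.
move=> nex; have Z : grad met (f \o Ltrans k) p = 0.
  by apply: xgetPN => u uP; apply: nex; exists u.
rewrite Z (_ : tmap _ _ 0 = 0); last exact: dfun0.
apply: xgetPN => v vP; apply: nex.
exists (tmap (Ltrans k^-1%g) (k * p)%g v) => w.
apply: (etrans (esym (met_inv k p _ w).1)); rewrite kK.
by rewrite vP dk.
Qed.

End Gradient.

(** Since (k p)^-1 k = p^-1, the left trivialisation does not see a left translation; this carries
    the gradient term at h back to g. *)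
Lemma ltriv_Ltrans (R : realType) (n : nat) (G : lieGroupType R n) (k p : G) u :
  ltriv (k * p)%g (tmap (Ltrans k) p u) = ltriv p u.
Proof.
apply: (etrans (tmap_Ltrans _ k p u)).
exact: (congr1 (fun r => tmap (Ltrans r) p u) (etrans
  (congr1 (fun r => (r * k)%g) (invgM k p)) (mulgVK k p^-1%g))).
Qed.

Theorem corollary3p7 (R : realType) (n : nat) (G : lieGroupType R n)
    (G_connected : connected [set: G])
    (met : G -> 'rV[R]_n -> 'rV[R]_n -> R)
    (met_riemannian : is_riemannian met)
    (met_bi_invariant : bi_invariant met)
    (nabla : (G -> 'rV[R]_n) -> (G -> 'rV[R]_n) -> G -> 'rV[R]_n)
    (nabla_levi_civita : is_levi_civita met nabla)
    (V : G -> R) (V_smooth : smooth_fun V) (V_ge0 : forall x, 0 <= V x)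
    (g0 : G) (Vext : G -> G -> R) (Vext_smooth : smooth_fun2 Vext)
    (Vext_g0 : forall x, Vext x g0 = V x)
    (Vext_invariant : forall x y h, Vext (h * x)%g (h * y)%g = Vext x y)
    (a b : R) (lt_ab : a < b)
    (qa qb : G) (va vb : 'rV[R]_n)
    (g : R -> G) (g_Omega : Omega a b qa va qb vb g) :
  solves_second_order met nabla V a b g <->
  solves_reduced met Vext a b (left_velocity `[a, b] g)
    (fun t => (g0^-1 * g t)%g).
Proof.
pose f := Vext ^~ (1%g : G).
have fV : f \o Ltrans g0^-1%g = V.
  apply/funext => x; rewrite /f /Ltrans /= -(Vext_g0 x).
  by rewrite -(Vext_invariant x g0 g0^-1%g) mulVg.
have Vf : V \o Ltrans g0 = f.
  apply/funext => y; rewrite /f /Ltrans /= -(Vext_g0 _).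
  by rewrite -(Vext_invariant y 1%g g0) mulg1.
(* Smoothness of f is inherited from V, since f is V composed with the left translation by g0. *)
have sf p : msm f p.
  rewrite -Vf; apply: msm_msmap; first exact: msmap_Ltrans.
  exact: (smooth_funP V).1.
have gradE p : tmap (Ltrans (g0^-1 * p)^-1%g) (g0^-1 * p)%g
    (grad met f (g0^-1 * p)%g) = ltriv p (grad met V p).
  have E1 := grad_Ltrans met_riemannian met_bi_invariant (sf (Ltrans g0^-1%g
    p)).
  rewrite fV in E1; apply: (etrans _ (ltriv_Ltrans g0^-1%g p (grad met V p))).
  exact: (congr1 (ltriv (g0^-1 * p)%g) E1).
have step (sg : smooth_curve `[a, b] g) t : `[a, b]%classic t ->
    (covD nabla `[a, b] g (covD nabla `[a, b] g
        (covD nabla `[a, b] g (velocity `[a, b] g))) t +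
      curvature nabla (g t) (covD nabla `[a, b] g (velocity `[a, b] g) t)
        (velocity `[a, b] g t) (velocity `[a,
          b] g t) + grad met V (g t) = 0) <->
    (derivn_within `[a, b] 3 (left_velocity `[a, b] g) t +
      lie_bracket (G := G) (left_velocity `[a, b] g t)
        (derivn_within `[a, b] 2 (left_velocity `[a, b] g) t) +
      ltriv (g t) (grad met V (g t)) = 0 :> 'rV[R]_n).
  move=> It; rewrite (second_order_left met_riemannian met_bi_invariant
    nabla_levi_civita lt_ab sg It).
  rewrite -{1}(ltrivK (g t) (grad met V (g t))) -left_fieldD.
  split=> E0.
    apply: (@left_field_inj R n G (g t)).
    apply: (etrans E0).
    exact: (esym (left_field0 (g t))).
  exact: (etrans (congr1 (fun v => left_field v (g t)) E0) (left_field0 _)).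
(* The equation for the velocity of h is an identity for every smooth g, because left translation by
   g0^-1 carries each left-invariant field to itself. *)
have velE (sg : smooth_curve `[a, b] g) t : `[a, b]%classic t ->
    velocity `[a, b] (fun s => (g0^-1 * g s)%g) t =
    tmap (Ltrans (g0^-1 * g t)%g) 1%g (left_velocity `[a, b] g t).
  move=> It.
  apply: (etrans (velocity_map lt_ab (msmap_Ltrans g0^-1%g) sg It)).
  apply: (etrans _ (tmap_left_field g0^-1%g (g t) (left_velocity `[a, b] g t))).
  exact: (congr1 (tmap (Ltrans g0^-1%g) (g t)) (esym (ltrivK (g t) _))).
split=> [[sg eq]|[_ sh eq]].
  split.
  - apply/(smooth_within_itvP lt_ab).
    apply/(smooth_along_ltriv lt_ab sg (velocity `[a, b] g)).
    exact: smooth_along_velocity.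
  - exact: (smooth_curve_map lt_ab (msmap_Ltrans g0^-1%g) sg).
  - move=> t It; split; last exact: velE.
    by apply: (etrans (congr1 (fun v => _ + v) (gradE (g t))));
      exact/(step sg t It)/eq.
(* Here smoothness is given for h; translating back by g0 yields it for g. *)
have sg : smooth_curve `[a, b] g.
  have := smooth_curve_map lt_ab (msmap_Ltrans g0) sh.
  rewrite (_ : Ltrans g0 \o _ = g)//.
  by apply/funext => t; exact: mulVKg.
split=> // t It; apply/(step sg t It).
apply: (etrans _ (eq t It).1).
exact: (congr1 (fun v => _ + v) (esym (gradE (g t)))).
Qed.
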